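(* Let $n\ge1$, $a_0>0$, and let either $a_1=0$ and $\sigma\in\mathbb{R}$ (so that $T_1=\infty$), or $a_1\ne0$ and $\sigma=-1+2/n$ (so that $T_1=\infty$ when $a_1>0$ and $T_1=T_0>0$ when $a_1<0$). Let $\lambda\in\mathbb{R}$, $1<p<\infty$, and let $f(Y)=\lambda|Y|^{p-1}Y$ or $f(Y)=\lambda|Y|^p$. Consider the Cauchy problem $$D_t^2Y(t)+A(t)Y(t)+f(Y)(t)=0,\qquad Y(0)=Y_0,\quad D_tY(0)=Y_1. \qquad (\mathrm{CP})$$ Then the following hold. (1) There are constants $C_0>0$ and $C>0$, independent of $Y_0$ and $Y_1$, such that for any $Y_0,Y_1\in\mathbb{R}^n$ and any $R_0>0$, $R_1>0$ with $R_0\ge2|Y_0|$ and $R_1\ge C_0|Y_1|$, there exists $T>0$ such that (CP) has a unique solution $Y\in X(T,R_0,R_1)$, where $T$ (with $T\le T_1$) can be taken arbitrarily subject to $$0<T\le\min\left\{\frac{C}{R_0^{p-1}},\ \frac{C}{R_0^{(p-1)/2}},\ \frac{CR_1}{R_0^p},\ \frac{R_0}{2R_1}\right\}.$$ (2) When $\sigma=-1+2/n$ and $a_1<0$ (so that $T_1=T_0>0$), if $|Y_0|$ and $|Y_1|$ are sufficiently small, then the solution $Y$ in (1) is a global solution. Moreover: (a) The solution $Y$ in (1) satisfies $Y\in C^1([0,T))$. (b) The solution $Y$ in (1) is unique in $C^1([0,T))\cap\{Y:\ \|Y\|_{L^\infty((0,T))}<\infty,\ \|D_tY\|_{L^\infty((0,T))}<\infty\}$.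 (c) If $\lambda\ge0$ and $f(Y)=\lambda|Y|^{p-1}Y$, then the solution $Y$ in (1) is a global solution; namely, it exists on $[0,T_1)$.
   Context: $D_t:=d/dt$. For $n\ge1$, $a_0>0$, $a_1,\sigma\in\mathbb{R}$: if $\sigma\ne-1$ and $a_1\neq 0$ put $T_0:=-\frac{2a_0}{n(1+\sigma)a_1}$; put $T_1:=T_0$ if $(1+\sigma)a_1<0$ and $T_1:=\infty$ if $(1+\sigma)a_1\ge0$. The scale-function is, for $0\le t<T_1$, $a(t):=a_0\left(1+\frac{n(1+\sigma)a_1t}{2a_0}\right)^{2/(n(1+\sigma))}$ if $\sigma\neq-1$ and $a(t):=a_0e^{a_1t/a_0}$ if $\sigma=-1$. Put $q_0(t):=\frac{D_t(a(t)^2)}{a(t)^2}$ and $A(t):=-\frac14q_0(t)^2-\frac12D_tq_0(t)$. (Under the hypotheses of the theorem $A\equiv0$ on $[0,T_1)$.) $Y=(Y^1,\dots,Y^n)$ is $\mathbb{R}^n$-valued and $|Y|=\{\sum_{j=1}^n(Y^j)^2\}^{1/2}$. In the case $f(Y)=\lambda|Y|^p$ the equation is read componentwise, every component of $f(Y)$ being $\lambda|Y|^p$. For $T,R_0,R_1>0$: $X(T,R_0,R_1):=\{Y:\ \|Y\|_{L^\infty((0,T))}\le R_0,\ \|D_tY\|_{L^\infty((0,T))}\le R_1\}$. The problem is considered on $[0,T)$ with $0<T\le T_1$. A solution of (CP) on $[0,T)$ means a fixed point of the integral operator $\Psi(Y)^j(t):=\rho_0(t)Y_0^j+\rho_1(t)Y_1^j-\int_0^t\rho_{12}(t,s)f(Y)^j(s)\,ds$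 ($1\le j\le n$), where $\rho_0,\rho_1$ solve $(D_t^2+A(t))\rho_i=0$ with $\rho_0(0)=1$, $D_t\rho_0(0)=0$, $\rho_1(0)=0$, $D_t\rho_1(0)=1$, and $\rho_{12}(t,s):=-\rho_0(t)\rho_1(s)+\rho_1(t)\rho_0(s)$. A global solution is one that exists on $[0,T_1)$. *)

(* Defs.v *)
From HB Require Import structures.
From mathcomp Require Export all_boot all_order all_algebra.
From mathcomp Require Export all_classical all_reals all_analysis.

Set Implicit Arguments.
Unset Strict Implicit.
Unset Printing Implicit Defensive.

Import Order.TTheory GRing.Theory Num.Theory.
Import numFieldNormedType.Exports.

Local Open Scope classical_set_scope.
Local Open Scope ring_scope.

Section time_intervals.
Context {R : realType}.

(* [0, T), where [T] may be +oo *)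
Definition time_interval (T : \bar R) : set R :=
  [set t | 0 <= t /\ (t%:E < T)%E].

(* [g] is the derivative of [f] on [D]; difference quotients only use points of
   [D], so the derivative is one-sided at an endpoint belonging to [D]. *)
Definition is_deriv_in (D : set R) (f g : R -> R) : Prop :=
  forall t, D t -> (f s - f t) / (s - t) @[s --> within D t^'] --> g t.

Definition C1_in n (D : set R) (Y : R -> 'rV[R]_n) : Prop :=
  forall j, exists g : R -> R,
    is_deriv_in D (fun t => Y t ord0 j) g /\ {within D, continuous g}.

End time_intervals.

Section scale_factor.
Context {R : realType}.
Variables (n : nat) (a0 a1 sigma : R).

(* Only meaningful when sigma != -1 and a1 != 0. *)
Definition T_0 : R := - (2 * a0 / (n%:R * (1 + sigma) * a1)).

Definition T_1 : \bar R :=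
  if (1 + sigma) * a1 < 0 then T_0%:E else +oo%E.

(* The formula is used for all real [t]; on a neighbourhood of each point of
   [0, T_1) it is smooth, so that the two-sided derivatives below exist there. *)
Definition scale_function (t : R) : R :=
  if sigma == -1 then a0 * expR (a1 * t / a0)
  else a0 * (1 + n%:R * (1 + sigma) * a1 * t / (2 * a0))
              `^ (2 / (n%:R * (1 + sigma))).

Definition q_0 (t : R) : R := derive1 (fun s => scale_function s ^+ 2) t / scale_function t ^+ 2.

Definition potential (t : R) : R := - (q_0 t ^+ 2 / 4) - derive1 q_0 t / 2.

End scale_factor.

Section Lebesgue_spaces.
Context {R : realType}.

(* The Euclidean norm; the library norm [`|_|] on matrices is the sup norm. *)
Definition enorm n (Y : 'rV[R]_n) : R := Num.sqrt (\sum_(j < n) Y ord0 j ^+ 2).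

(* The norm of L^oo((0, T); R^n): extending [|Y|] by 0 outside (0, T) does not
   change its essential supremum, as [|Y| >= 0]. *)
Definition Linfty_norm n (T : R) (Y : R -> 'rV[R]_n) : \bar R :=
  Lnorm (@lebesgue_measure R) +oo%E
    (EFin \o ((fun t => enorm (Y t)) \_ `]0, T[)).

Definition measurable_on n (T : R) (Y : R -> 'rV[R]_n) : Prop :=
  forall j, measurable_fun `]0, T[ (fun t : measurableTypeR R => Y t ord0 j).

Definition Linfty_le n (T : R) (Y : R -> 'rV[R]_n) (r : R) : Prop :=
  measurable_on T Y /\ (Linfty_norm T Y <= r%:E)%E.

Definition Linfty_finite n (T : R) (Y : R -> 'rV[R]_n) : Prop :=
  measurable_on T Y /\ (Linfty_norm T Y < +oo)%E.

(* Test functions: C^oo with compact support in (0, T). *)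
Definition test_function (T : R) (phi : R -> R) : Prop :=
  (forall k x, derivable (derive1n k phi) x 1) /\
  (exists a b : R, [/\ 0 < a, b < T & forall x, x \notin `[a, b] -> phi x = 0]).

(* [V] is the distributional derivative D_t Y on (0, T). *)
Definition weak_deriv n (T : R) (Y V : R -> 'rV[R]_n) : Prop :=
  forall (phi : R -> R) (j : 'I_n), test_function T phi ->
    \int[@lebesgue_measure R]_(t in `]0, T[) (Y t ord0 j * derive1 phi t) =
    - \int[@lebesgue_measure R]_(t in `]0, T[) (V t ord0 j * phi t).

Definition X_space n (T R0 R1 : R) : set (R -> 'rV[R]_n) :=
  [set Y | Linfty_le T Y R0 /\
           exists V, weak_deriv T Y V /\ Linfty_le T V R1].

Definition bounded_C1 n (T : R) : set (R -> 'rV[R]_n) :=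
  [set Y | C1_in (time_interval T%:E) Y] `&`
  [set Y | Linfty_finite T Y /\ exists V, weak_deriv T Y V /\ Linfty_finite T V].

End Lebesgue_spaces.
Arguments X_space {R} n T R0 R1.
Arguments bounded_C1 {R} n T.

Section Cauchy_problem.
Context {R : realType}.

Definition f_gauge n (lambda p : R) (Y : 'rV[R]_n) : 'rV[R]_n :=
  (lambda * enorm Y `^ (p - 1)) *: Y.

Definition f_power n (lambda p : R) (Y : 'rV[R]_n) : 'rV[R]_n :=
  const_mx (lambda * enorm Y `^ p).

(* [rho] solves (D_t^2 + A) rho = 0 on [D], rho(0) = r0, D_t rho(0) = r1. *)
Definition linear_ivp (D : set R) (A : R -> R) (r0 r1 : R) (rho : R -> R) : Prop :=
  exists rho' : R -> R,
    [/\ is_deriv_in D rho rho',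
        is_deriv_in D rho' (fun t => - (A t * rho t)),
        rho 0 = r0 & rho' 0 = r1].

Definition rho12 (rho0 rho1 : R -> R) (t s : R) : R :=
  - (rho0 t * rho1 s) + rho1 t * rho0 s.

Definition Psi n (rho0 rho1 : R -> R) (f : 'rV[R]_n -> 'rV[R]_n)
    (Y0 Y1 : 'rV[R]_n) (Y : R -> 'rV[R]_n) (t : R) : 'rV[R]_n :=
  \row_j (rho0 t * Y0 ord0 j + rho1 t * Y1 ord0 j
    - \int[@lebesgue_measure R]_(s in `[0, t]) (rho12 rho0 rho1 t s * f (Y s) ord0 j)).

(* Fixed point of [Psi] on [0, T). The integrability clause says that [Psi Y]
   is defined: the library integral is total. *)
Definition solution n (rho0 rho1 : R -> R) (f : 'rV[R]_n -> 'rV[R]_n)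
    (Y0 Y1 : 'rV[R]_n) (T : \bar R) (Y : R -> 'rV[R]_n) : Prop :=
  forall t, time_interval T t ->
    (forall j, integrable (@lebesgue_measure R) `[0, t]
       (fun s => (rho12 rho0 rho1 t s * f (Y s) ord0 j)%:E)) /\
    Y t = Psi rho0 rho1 f Y0 Y1 Y t.

(* Functions on [0, T) are represented by functions on [R] whose values outside
   [0, T) are irrelevant, hence uniqueness up to equality on [0, T). *)
Definition unique_solution_in n (S : set (R -> 'rV[R]_n)) (rho0 rho1 : R -> R)
    (f : 'rV[R]_n -> 'rV[R]_n) (Y0 Y1 : 'rV[R]_n) (T : \bar R)
    (Y : R -> 'rV[R]_n) : Prop :=
  [/\ S Y, solution rho0 rho1 f Y0 Y1 T Y &
      forall Z, S Z -> solution rho0 rho1 f Y0 Y1 T Z ->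
        {in time_interval T, Z =1 Y}].

(* A solution [Y] on [0, T) is global when it exists on the whole of
   [0, Tmax), i.e. is the restriction of a solution on [0, Tmax). *)
Definition is_global n (rho0 rho1 : R -> R) (f : 'rV[R]_n -> 'rV[R]_n)
    (Y0 Y1 : 'rV[R]_n) (Tmax T : \bar R) (Y : R -> 'rV[R]_n) : Prop :=
  exists Z, solution rho0 rho1 f Y0 Y1 Tmax Z /\ {in time_interval T, Z =1 Y}.

Definition admissible_data n (C0 : R) (Y0 Y1 : 'rV[R]_n) (R0 R1 : R) : Prop :=
  [/\ 0 < R0, 0 < R1, 2 * enorm Y0 <= R0 & C0 * enorm Y1 <= R1].

Definition admissible_time (C p R0 R1 : R) (Tmax : \bar R) (T : R) : Prop :=
  [/\ 0 < T, (T%:E <= Tmax)%E &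
      T <= Num.min (C / R0 `^ (p - 1))
          (Num.min (C / R0 `^ ((p - 1) / 2))
          (Num.min (C * R1 / R0 `^ p) (R0 / (2 * R1))))].

End Cauchy_problem.

(* Main.v *)
Require Import Defs.
From HB Require Import structures.
From mathcomp Require Import all_boot all_order all_algebra.
From mathcomp Require Import all_classical all_reals all_analysis.
From mathcomp Require Import measurable_realfun ess_sup_inf.
From mathcomp Require Import ring lra.
Import Order.TTheory GRing.Theory Num.Theory.
Import numFieldNormedType.Exports.
Local Open Scope classical_set_scope.
Local Open Scope ring_scope.

(** In all the cases considered the scale factor is affine, [a(t) = a0 + a1 t],
    so the potential [A] vanishes on [0, T1) ([potential_eq0]), the fundamental
    solutions are [rho0 = 1] and [rho1 = t] ([linear_ivp_affine]), and the
    integral equation is that of the autonomous problem [Y'' + f(Y) = 0]: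
    [Y(t) = Y0 + t Y1 - \int_0^t (t - s) f(Y(s)) ds].

    A fixed point of the integral operator is automatically continuous, hence a
    classical solution, and conversely ([solution_classical],
    [classical_solution]).  Since [f] is Lipschitz on bounded sets
    ([f_gauge_lipschitz], [f_power_lipschitz]), two solutions on [0, T) agree
    whatever space they lie in ([solution_unique]).  Both uniqueness claims are
    thereby reduced to existence, and the regularity claim holds because the
    solution is the classical one.

    Existence.  Truncating the coordinates of [Y] to [-r, r] makes [f] globally
    Lipschitz with coordinates bounded by [K r^p].  For a globally Lipschitz nonlinearity
    Picard iteration converges on every bounded interval, by contraction in the
    supremum norm with an exponential weight ([classical_exists]).  If the data
    and the time are small relative to [r], the bound [K r^p] confines the
    solution to the ball of radius [r], where the truncation is inactive
    ([small_classical]).  With [r = R0] this gives the local solution, and with a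
    suitable fixed [r] on the finite interval [0, T1) the global solution for
    small data.

    When [lambda >= 0] and [f(Y) = lambda |Y|^(p-1) Y], the energy
    [|Y'|^2 / 2 + Phi(|Y|^2)] is conserved and [Phi >= 0], so that [|Y'|] is
    bounded a priori and [|Y(t)|] grows at most linearly.  Truncating at a radius
    exceeding this bound gives a solution on any bounded interval
    ([gauge_classical_exists]); by uniqueness these glue together
    ([glued_solution]). *)

(** * Calculus on the line *)

Section calculus.
Context {R : realType}.
Notation mu := (@lebesgue_measure R).
Implicit Types (g h k : R -> R) (s t T : R).

Lemma is_derive_continuous h (dh : R) t :
  is_derive t 1 h dh -> {for t, continuous h}.
Proof. by case=> dht _; apply/differentiable_continuous/derivable1_diffP. Qed.

Lemma derivative_ge0_le {h dh} {a b : R} : a <= b ->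
  (forall s, a <= s <= b -> is_derive s 1 h (dh s)) ->
  (forall s, a <= s <= b -> 0 <= dh s) -> h a <= h b.
Proof.
move=> ab hd dh0; apply: (@ger0_derive1_ndecr _ h a b) => //.
- by move=> x; rewrite in_itv/= => /andP[/ltW ax /ltW xb];
     have [] := hd x; rewrite ?ax.
- move=> x; rewrite in_itv/= => /andP[/ltW ax /ltW xb].
  have H : is_derive x 1 h (dh x) by apply: hd; rewrite ax.
  by rewrite derive1E derive_val dh0 ?ax.
- apply: derivable_within_continuous => x; rewrite in_itv/= => xab.
  by have [] := hd x xab.
Qed.

(** The mean value inequality in comparison form: [k] dominates [h] as soon as
    it does so at 0 and [dk] dominates [dh]. *)
Lemma derivative_bound {h dh k dk} {t} : 0 <= t ->
  (forall s, 0 <= s <= t -> is_derive s 1 h (dh s)) ->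
  (forall s, 0 <= s <= t -> is_derive s 1 k (dk s)) ->
  (forall s, 0 <= s <= t -> `|dh s| <= dk s) ->
  `|h 0| <= k 0 -> `|h t| <= k t.
Proof.
move=> t0 hd kd le_d; rewrite !ler_norml => /andP[lo hi].
have := @derivative_ge0_le (k + h) (fun s => dk s + dh s) _ _ t0.
have := @derivative_ge0_le (k - h) (fun s => dk s - dh s) _ _ t0.
rewrite !fctE => Hm Hp.
have {}Hm : k 0 - h 0 <= k t - h t.
  apply: Hm => s st.
  - by have := kd s st; have := hd s st => ? ?; exact: is_deriveB.
  - by have := le_d s st; rewrite ler_norml => /andP[_]; rewrite subr_ge0.
have {}Hp : k 0 + h 0 <= k t + h t.
  apply: Hp => s st.
  - by have := kd s st; have := hd s st => ? ?; exact: is_deriveD.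
  - by have := le_d s st; rewrite ler_norml => /andP[? _]; rewrite -lerBlDl sub0r.
by apply/andP; split; lra.
Qed.

Lemma derivative_eq {h k d} {t} : 0 <= t ->
  (forall s, 0 <= s <= t -> is_derive s 1 h (d s)) ->
  (forall s, 0 <= s <= t -> is_derive s 1 k (d s)) ->
  h 0 = k 0 -> h t = k t.
Proof.
move=> t0 hd kd hk0; apply/eqP; rewrite -subr_eq0 -normr_le0.
apply: (@derivative_bound (h - k) (fun=> 0) (cst 0) (fun=> 0) _ t0).
- move=> s st; have := hd s st; have := kd s st => H1 H2.
  by have -> : 0 = d s - d s; [rewrite subrr | exact: is_deriveB].
- by move=> s _; rewrite normr0.
- by rewrite !fctE hk0 subrr normr0.
Qed.

Lemma continuous_integrable_cc g (a b : R) :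
  continuous g -> mu.-integrable `[a, b] (EFin \o g).
Proof.
move=> cg; apply: continuous_compact_integrable; first exact: segment_compact.
exact: continuous_subspaceT.
Qed.

(** The antiderivative of [g] vanishing at 0; for [t <> 0] one of the
    two integrals is over an empty set, which gives the sign convention for
    negative [t]. *)
Definition primitive g t : R :=
  (\int[mu]_(s in `[0, t]) g s) - (\int[mu]_(s in `[t, 0]) g s).

Lemma Rintegral_ccB {g} {a b c : R} : continuous g -> a <= b -> b <= c ->
  (\int[mu]_(s in `[a, c]) g s) - (\int[mu]_(s in `[a, b]) g s) =
  \int[mu]_(s in `[b, c]) g s.
Proof.
move=> cg ab bc.
rewrite (@Rintegral_itvB _ _ (BLeft a) (BRight c)) ?bnd_simp//; last first.
  exact: continuous_integrable_cc.
rewrite Rintegral_itv_obnd_cbnd//.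
apply: integrableS (continuous_integrable_cc _ b c cg) => //.
by apply: subset_itv; rewrite bnd_simp.
Qed.

Lemma Rintegral_itv_ge g (a b : R) : b <= a -> \int[mu]_(s in `[a, b]) g s = 0.
Proof.
rewrite le_eqVlt => /predU1P[->|ba].
  by rewrite set_itv1 Rintegral_set1.
by rewrite set_itv_ge ?bnd_simp -?ltNge// Rintegral_set0.
Qed.

Lemma primitiveE {g} {a t : R} : continuous g -> a <= 0 -> a <= t ->
  primitive g t =
  (\int[mu]_(s in `[a, t]) g s) - (\int[mu]_(s in `[a, 0]) g s).
Proof.
move=> cg a0 at_; rewrite /primitive; have [t0|/ltW t0] := leP 0 t.
  by rewrite (Rintegral_itv_ge _ _ _ t0) subr0 Rintegral_ccB.
by rewrite (Rintegral_itv_ge _ _ _ t0) sub0r -(Rintegral_ccB cg at_ t0) opprB.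
Qed.

Lemma is_derive_primitive g t :
  continuous g -> is_derive t 1 (primitive g) (g t).
Proof.
(* Integration from a point to the left of both 0 and [t] makes [t] interior. *)
move=> cg; pose a := Num.min 0 t - 1.
have m0 : Num.min 0 t <= 0 by rewrite ge_min lexx.
have mt : Num.min 0 t <= t by rewrite ge_min lexx orbT.
have a0 : a <= 0 by rewrite /a; lra.
have at_ : a < t by rewrite /a; lra.
apply: (@near_eq_is_derive _ _ _ (fun y =>
   (\int[mu]_(s in `[a, y]) g s) - (\int[mu]_(s in `[a, 0]) g s))).
  by near=> y; rewrite (primitiveE cg a0)//; apply: ltW; near: y;
    exact: lt_nbhsr.
have [|//|dF Fg] := @continuous_FTC1_closed _ g a t (t + 1) _ _ at_ (cg t).
- by rewrite ltrDl.
- exact: continuous_integrable_cc.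
have H : is_derive t 1 (fun y => \int[mu]_(s in `[a, y]) g s) (g t).
  by rewrite -Fg derive1E; exact/derivableP.
rewrite -[g t]subr0.
exact: is_deriveB H (is_derive_cst _ _ _).
Unshelve. all: by end_near. Qed.

Lemma primitive0 g : primitive g 0 = 0.
Proof. by rewrite /primitive subrr. Qed.

Lemma continuous_primitive g : continuous g -> continuous (primitive g).
Proof. by move=> cg t; exact: is_derive_continuous (is_derive_primitive g t cg). Qed.

(** The nearest point of [a, b], for [a <= b].  Composition with it turns a
    function continuous on [a, b] into one continuous on the whole line. *)
Definition clip (a b t : R) : R := Num.max a (Num.min b t).

Lemma clip_id a b t : a <= t <= b -> clip a b t = t.
Proof. by case/andP=> at_ tb; rewrite /clip (min_idPr tb) (max_idPr at_). Qed.

Lemma clip_in a b t : a <= b -> a <= clip a b t <= b.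
Proof. by move=> ab; rewrite /clip le_max lexx ge_max ab ge_min lexx. Qed.

Lemma clip_continuous a b : continuous (clip a b).
Proof.
move=> t; apply: (@continuous_max _ _ (cst a) (fun t => Num.min b t) t).
  exact: cst_continuous.
apply: (@continuous_min _ _ (cst b) id t); first exact: cst_continuous.
exact: cvg_id.
Qed.

Lemma continuous_clip (a b : R) g : a <= b ->
  {within `[a, b], continuous g} -> continuous (g \o clip a b).
Proof.
move=> ab /subspace_continuousP cg t.
have tab : `[a, b]%classic (clip a b t) by rewrite /= in_itv/= clip_in.
apply: (@cvg_comp _ _ _ (clip a b) g (nbhs t)
  (within `[a, b] (nbhs (clip a b t)))); last exact: cg.
move=> A HA; have {}HA : nbhs t (clip a b @^-1` [set x | `[a, b]%classic x -> A x]).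
  exact: (clip_continuous a b t _ HA).
change (nbhs t (clip a b @^-1` A)); apply: filterS HA => s /=.
by apply; rewrite /= in_itv/= clip_in.
Qed.

(** Taylor's formula of order 2 with integral remainder. *)
Lemma taylor2_integral {W V g} {t} : 0 <= t ->
  (forall s, 0 <= s <= t -> is_derive s 1 W (V s)) ->
  (forall s, 0 <= s <= t -> is_derive s 1 V (- g s)) ->
  {within `[0, t], continuous g} ->
  W t = W 0 + t * V 0 - \int[mu]_(s in `[0, t]) ((t - s) * g s).
Proof.
rewrite le_eqVlt => /predU1P[<- _ _ _|t0 dW dV cg].
  by rewrite set_itv1 Rintegral_set1 mul0r addr0 subr0.
(* An antiderivative of the integrand. *)
pose F s := - ((t - s) * V s + W s).
have dF s : 0 <= s <= t -> is_derive s 1 F ((t - s) * g s).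
  move=> st; have ? := dW s st; have ? := dV s st.
  apply: (@is_derive_eq _ _ _ (- ((fun s => t - s) * V + W))).
  rewrite !/GRing.scale/=; ring.
have cF s : 0 <= s <= t -> {for s, continuous F}.
  by move=> st; exact: is_derive_continuous (dF s st).
have := @continuous_FTC2 _ (fun s => (t - s) * g s) F 0 t t0.
rewrite /Rintegral => -> //=.
- by rewrite /F subrr mul0r subr0; ring.
- move=> x; apply: (@continuousM R (subspace `[0, t]) (fun s => t - s) g).
    have cB : continuous (fun s : R => t - s).
      by move=> s; apply: continuousB; [exact: cst_continuous | exact: cvg_id].
    exact: (continuous_subspaceT cB).
  exact: cg.
- split.
  + by move=> x /[!in_itv]/= /andP[/ltW x0 /ltW xt]; have [] := dF x; rewrite ?x0.
  + by apply: cvg_at_right_filter; apply: cF; rewrite lexx ltW.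
  + by apply: cvg_at_left_filter; apply: cF; rewrite lexx ltW.
- move=> x /[!in_itv]/= /andP[/ltW x0 /ltW xt].
  have H : is_derive x 1 F ((t - x) * g x) by apply: dF; rewrite x0.
  by rewrite derive1E derive_val.
Qed.

End calculus.

(** * The nonlinearity *)

Section nonlinearity.
Context {R : realType}.
Implicit Types (r B p lambda : R).

Lemma powRB_le p (a b : R) : 1 < p -> 0 <= a <= b ->
  b `^ p - a `^ p <= p * b `^ (p - 1) * (b - a).
Proof.
move=> p1 /andP[]; rewrite le_eqVlt => /predU1P[<- b0|a0 ab].
  rewrite powR0 ?gt_eqF ?(lt_trans _ p1)// !subr0 -mulrA.
  rewrite [_ `^ (p - 1) * _]mulrC mulr_powRB1 ?(lt_trans _ p1)//.
  by rewrite ler_peMl ?powR_ge0 ?ltW.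
pose h x := p * b `^ (p - 1) * x - x `^ p.
suff : h a <= h b by rewrite /h; lra.
apply: (@derivative_ge0_le _ h
  (fun x => p * b `^ (p - 1) - p * x `^ (p - 1))) => // x /andP[ax xb].
  have x0 : 0 < x by exact: lt_le_trans ax.
  have H := @is_derive1_powR _ p x x0.
  have -> : h = ((p * b `^ (p - 1)) \*: (@id R)) - (fun y => y `^ p) by [].
  by apply: is_derive_eq; rewrite /GRing.scale/= mulr1.
by rewrite subr_ge0 ler_pM2l ?(lt_trans _ p1)// ge0_ler_powR ?nnegrE//; lra.
Qed.

Section euclidean_norm.
Context {n : nat}.
Implicit Types Y Z : 'rV[R]_n.

Lemma enorm_ge0 Y : 0 <= enorm Y. Proof. exact: sqrtr_ge0. Qed.

Lemma sqr_enorm Y : enorm Y ^+ 2 = \sum_(j < n) Y ord0 j ^+ 2.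
Proof. by rewrite sqr_sqrtr// sumr_ge0// => j _; rewrite sqr_ge0. Qed.

Lemma le_enorm Y r : 0 <= r ->
  (enorm Y <= r) = (\sum_(j < n) Y ord0 j ^+ 2 <= r ^+ 2).
Proof. by move=> r0; rewrite -sqr_enorm ler_sqr// nnegrE enorm_ge0. Qed.

Lemma coord_le_enorm Y j : `|Y ord0 j| <= enorm Y.
Proof.
rewrite -ler_sqr ?nnegrE ?enorm_ge0// sqr_enorm real_normK ?num_real//.
by rewrite (bigD1 j)//= lerDl sumr_ge0// => i _; rewrite sqr_ge0.
Qed.

Lemma sum_sqr_le (y : 'I_n -> R) B : (forall j, `|y j| <= B) ->
  \sum_(j < n) y j ^+ 2 <= n%:R * B ^+ 2.
Proof.
move=> yB; apply: le_trans (_ : \sum_(j < n) B ^+ 2 <= _).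
  apply: ler_sum => j _; rewrite -[y j ^+ 2]real_normK ?num_real//.
  by rewrite ler_sqr ?nnegrE// (le_trans _ (yB j)).
by rewrite sumr_const card_ord mulr_natl.
Qed.

Lemma enorm_le_coord Y B : 0 <= B -> (forall j, `|Y ord0 j| <= B) ->
  enorm Y <= Num.sqrt n%:R * B.
Proof.
move=> B0 YB; rewrite le_enorm ?mulr_ge0 ?sqrtr_ge0//.
by rewrite exprMn sqr_sqrtr ?ler0n// sum_sqr_le.
Qed.

(** A crude Lipschitz bound, coming from
    [|Y|^2 - |Z|^2 = \sum (Y_j - Z_j) (Y_j + Z_j)]. *)
Lemma enorm_dist Y Z B : (forall j, `|Y ord0 j - Z ord0 j| <= B) ->
  `|enorm Y - enorm Z| <= n%:R * B.
Proof.
move=> YZ; have [s0|s0] := leP (enorm Y + enorm Z) 0.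
  have := enorm_ge0 Y; have := enorm_ge0 Z => z0 y0.
  have -> : enorm Y = 0 by lra.
  have -> : enorm Z = 0 by lra.
  rewrite subrr normr0; case: n Y Z YZ {s0 z0 y0} => [|m] Y Z YZ.
    by rewrite mul0r.
  by rewrite mulr_ge0// (le_trans _ (YZ ord0)).
rewrite -(ler_pM2r s0) -[X in _ * X <= _]gtr0_norm// -normrM -subr_sqr.
rewrite !sqr_enorm -sumrB (le_trans (ler_norm_sum _ _ _))//.
apply: le_trans (_ : \sum_(j < n) B * (enorm Y + enorm Z) <= _).
  apply: ler_sum => j _; rewrite subr_sqr normrM ler_pM//.
  by rewrite (le_trans (ler_normD _ _))// lerD// coord_le_enorm.
by rewrite sumr_const card_ord -mulrA mulr_natl.
Qed.

(** Lipschitz continuity, in each coordinate and for the supremum norm. *)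
Definition lipschitz_coord (D : set 'rV[R]_n) (L : R)
    (f : 'rV[R]_n -> 'rV[R]_n) : Prop :=
  forall Y Z B, D Y -> D Z -> (forall j, `|Y ord0 j - Z ord0 j| <= B) ->
    forall j, `|f Y ord0 j - f Z ord0 j| <= L * B.

(** The closed ball of radius [r] for the supremum norm. *)
Definition cube r : set 'rV[R]_n := [set Y | forall j, `|Y ord0 j| <= r].

(** Lipschitz continuity on bounded sets. *)
Definition locally_lipschitz (f : 'rV[R]_n -> 'rV[R]_n) : Prop :=
  forall r, exists2 L : R, 0 <= L & lipschitz_coord (cube r) L f.

(** Truncation of every coordinate to [-r, r]. *)
Definition truncate r Y : 'rV[R]_n := \row_j clip (- r) r (Y ord0 j).

Lemma truncate_id r Y : cube r Y -> truncate r Y = Y.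
Proof.
by move=> Yr; apply/rowP => j; rewrite mxE clip_id// -ler_norml Yr.
Qed.

Lemma truncate_cube r Y : 0 <= r -> cube r (truncate r Y).
Proof.
by move=> r0 j; rewrite mxE ler_norml clip_in// (le_trans _ r0)// oppr_le0.
Qed.

Lemma clip_dist (a b x y : R) : `|clip a b x - clip a b y| <= `|x - y|.
Proof.
rewrite /clip; wlog xy : x y / x <= y => [H|].
  have [|/ltW yx] := leP x y; first exact: H.
  by rewrite distrC [leRHS]distrC H.
rewrite [leRHS]distrC [leLHS]distrC !ger0_norm ?subr_ge0//; last first.
  by rewrite ge_max le_max lexx/= le_max !le_min !ge_min lexx xy/= !orbT.
by rewrite !maxEle !minEle; case: ifP; case: ifP; case: ifP; case: ifP; lra.
Qed.

Lemma truncate_lipschitz f r : 0 <= r -> locally_lipschitz f ->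
  exists2 L : R, 0 <= L & lipschitz_coord setT L (f \o truncate r).
Proof.
move=> r0 /(_ r)[L L0 fL]; exists L => // Y Z B _ _ YZ; apply: fL.
- exact: truncate_cube.
- exact: truncate_cube.
- by move=> j; rewrite !mxE (le_trans (clip_dist _ _ _ _)).
Qed.

Lemma continuous_comp_lipschitz f (Y : R -> 'rV[R]_n) t :
  locally_lipschitz f ->
  (forall j, {for t, continuous (fun s => Y s ord0 j)}) ->
  forall j, {for t, continuous (fun s => f (Y s) ord0 j)}.
Proof.
move=> fL cY j; pose r := enorm (Y t) + 1.
have [L L0 HL] := fL r; apply/cvgrPdist_le => /= e e0.
pose B := Num.min 1 (e / (L + 1)).
have L1 : 0 < L + 1 by rewrite ltr_wpDl.
have B0 : 0 < B by rewrite lt_min ltr01 divr_gt0.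
have near_t : \forall s \near t, forall i, `|Y t ord0 i - Y s ord0 i| <= B.
  apply: (@filter_forall R 'I_n (fun i s => `|Y t ord0 i - Y s ord0 i| <= B) _
    (nbhs_filter t)).
  by move=> i; have /cvgrPdist_le/(_ _ B0) := cY i.
near=> s; have sB : forall i, `|Y t ord0 i - Y s ord0 i| <= B by near: s.
apply: (@le_trans _ _ (L * B)).
  apply: HL => // i; rewrite /r.
    by rewrite (le_trans (coord_le_enorm _ _))// lerDl.
  rewrite -[Y s ord0 i](subKr (Y t ord0 i)) (le_trans (ler_normB _ _))//.
  by rewrite lerD ?coord_le_enorm// (le_trans (sB i))// ge_min lexx.
apply: (@le_trans _ _ (L * (e / (L + 1)))).
  by rewrite ler_wpM2l// ge_min lexx orbT.
by rewrite mulrCA ler_piMr ?(ltW e0)// ler_pdivrMr// mul1r lerDl.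
Unshelve. all: by end_near. Qed.

End euclidean_norm.

Section power_nonlinearity.
Context {n : nat} {p lambda : R} (p1 : 1 < p).
Implicit Types Y Z : 'rV[R]_n.

Let p0 : 0 < p. Proof. exact: lt_trans p1. Qed.
Let pB1 : 0 <= p - 1. Proof. by rewrite subr_ge0 ltW. Qed.

Lemma f_gauge_le Y r : 0 <= r -> cube r Y -> forall j,
  `|f_gauge lambda p Y ord0 j| <= `|lambda| * Num.sqrt n%:R `^ p * r `^ p.
Proof.
move=> r0 Yr j; have eY := enorm_ge0 Y.
rewrite /f_gauge mxE normrM normrM -!mulrA ler_wpM2l// -powRM ?sqrtr_ge0//.
rewrite (ger0_norm (powR_ge0 _ _)).
apply: (@le_trans _ _ (enorm Y `^ p)).
  by rewrite -[leRHS]mulr_powRB1// mulrC ler_wpM2r ?powR_ge0 ?coord_le_enorm.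
by rewrite ge0_ler_powR ?nnegrE ?mulr_ge0 ?sqrtr_ge0 ?enorm_le_coord// ltW.
Qed.

Lemma f_power_le Y r : 0 <= r -> cube r Y -> forall j,
  `|f_power lambda p Y ord0 j| <= `|lambda| * Num.sqrt n%:R `^ p * r `^ p.
Proof.
move=> r0 Yr j; have eY := enorm_ge0 Y.
rewrite /f_power mxE normrM -!mulrA ler_wpM2l// -powRM ?sqrtr_ge0//.
rewrite (ger0_norm (powR_ge0 _ _)).
by rewrite ge0_ler_powR ?nnegrE ?mulr_ge0 ?sqrtr_ge0 ?enorm_le_coord// ltW.
Qed.

Let enorm_powR_dist Y Z r B : 0 <= r -> cube r Y -> enorm Z <= enorm Y ->
  (forall j, `|Y ord0 j - Z ord0 j| <= B) ->
  enorm Y `^ p - enorm Z `^ p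
    <= p * (Num.sqrt n%:R * r) `^ (p - 1) * (n%:R * B).
Proof.
move=> r0 Yr ZY YZ; apply: le_trans (powRB_le _ _ _ p1 _) _.
  by rewrite enorm_ge0.
rewrite -!mulrA ler_wpM2l ?(ltW p0)// ler_pM ?powR_ge0 ?subr_ge0//.
  by rewrite ge0_ler_powR ?nnegrE ?mulr_ge0 ?sqrtr_ge0 ?enorm_le_coord ?enorm_ge0.
by apply: le_trans (enorm_dist _ _ _ YZ); rewrite ler_norm.
Qed.

Let lip_const r := `|lambda| * ((1 + p * n%:R) * (Num.sqrt n%:R * r) `^ (p - 1)).

Let lip_const_ge0 r : 0 <= lip_const r.
Proof. by rewrite !mulr_ge0 ?powR_ge0// addr_ge0// mulr_ge0 ?(ltW p0). Qed.

(** For [|Z| <= |Y|] the difference of the unit-coefficient nonlinearities is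
    [|Y|^(p-1) (Y_j - Z_j) + (|Y|^(p-1) - |Z|^(p-1)) Z_j]; the second term
    is at most [|Y|^p - |Z|^p] because [|Z_j| <= |Z| <= |Y|]; this covers the
    exponents [p < 2], for which [|Y|^(p-1)] is not Lipschitz at 0. *)
Lemma f_gauge_lipschitz : locally_lipschitz (@f_gauge R n lambda p).
Proof.
move=> r; exists (lip_const r) => // Y Z B Yr Zr YZ j.
have r0 : 0 <= r by rewrite (le_trans _ (Yr j)).
have B0 : 0 <= B by rewrite (le_trans _ (YZ j)).
wlog ZY : Y Z Yr Zr YZ / enorm Z <= enorm Y => [H|].
  have [|/ltW YZ'] := leP (enorm Z) (enorm Y); first exact: H.
  by rewrite distrC H// => i; rewrite distrC.
rewrite /f_gauge !mxE /lip_const -[leRHS]mulrA.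
set b := enorm Y in ZY *; set a := enorm Z in ZY *.
have a0 : 0 <= a by exact: enorm_ge0.
have b0 : 0 <= b by exact: enorm_ge0.
have ab : a `^ (p - 1) <= b `^ (p - 1) by rewrite ge0_ler_powR ?nnegrE.
have -> : lambda * b `^ (p - 1) * Y ord0 j - lambda * a `^ (p - 1) * Z ord0 j =
  lambda * (b `^ (p - 1) * (Y ord0 j - Z ord0 j) +
  (b `^ (p - 1) - a `^ (p - 1)) * Z ord0 j) by ring.
rewrite normrM ler_wpM2l//.
set rho := (Num.sqrt n%:R * r) `^ (p - 1).
have -> : (1 + p * n%:R) * rho * B = rho * B + p * rho * (n%:R * B) by ring.
rewrite (le_trans (ler_normD _ _))// lerD//.
  rewrite normrM (ger0_norm (powR_ge0 _ _)) ler_pM ?powR_ge0//.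
  by rewrite ge0_ler_powR ?nnegrE ?mulr_ge0 ?sqrtr_ge0 ?enorm_le_coord.
apply: le_trans (enorm_powR_dist Y Z r B r0 Yr ZY YZ).
rewrite normrM ger0_norm ?subr_ge0//.
apply: (@le_trans _ _ ((b `^ (p - 1) - a `^ (p - 1)) * a)).
  by rewrite ler_wpM2l ?subr_ge0// coord_le_enorm.
rewrite mulrBl [X in _ - X]mulrC mulr_powRB1// lerD2r.
by rewrite -(mulr_powRB1 b0 p0) mulrC ler_wpM2r ?powR_ge0.
Qed.

Lemma f_power_lipschitz : locally_lipschitz (@f_power R n lambda p).
Proof.
move=> r; exists (lip_const r) => // Y Z B Yr Zr YZ j.
have r0 : 0 <= r by rewrite (le_trans _ (Yr j)).
have B0 : 0 <= B by rewrite (le_trans _ (YZ j)).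
wlog ZY : Y Z Yr Zr YZ / enorm Z <= enorm Y => [H|].
  have [|/ltW YZ'] := leP (enorm Z) (enorm Y); first exact: H.
  by rewrite distrC H// => i; rewrite distrC.
rewrite /f_power !mxE -mulrBr normrM /lip_const -[leRHS]mulrA ler_wpM2l//.
rewrite ger0_norm; last first.
  by rewrite subr_ge0 ge0_ler_powR ?nnegrE ?enorm_ge0 ?(ltW p0).
apply: le_trans (enorm_powR_dist Y Z r B r0 Yr ZY YZ) _.
set rho := (Num.sqrt n%:R * r) `^ (p - 1).
have -> : (1 + p * n%:R) * rho * B = rho * B + p * rho * (n%:R * B) by ring.
by rewrite lerDr mulr_ge0 ?powR_ge0.
Qed.

End power_nonlinearity.
End nonlinearity.

(** * Classical solutions: estimates and uniqueness *)

Section derivative_bounds.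
Context {R : realType}.
Implicit Types (h dh ddh : R -> R) (c m s t : R).

Lemma mean_value_bound {h dh} c {a b : R} : a <= b ->
  (forall s, a <= s <= b -> is_derive s 1 h (dh s)) ->
  (forall s, a <= s <= b -> `|dh s| <= c) -> `|h b - h a| <= c * (b - a).
Proof.
move=> ab hd dhc.
have cd s : is_derive s 1 (c \*: (@id R)) c.
  by apply: is_derive_eq; rewrite /GRing.scale/= mulr1.
have := @derivative_ge0_le R (c \*: (@id R) + h) (fun s => c + dh s) a b ab.
have := @derivative_ge0_le R (c \*: (@id R) - h) (fun s => c - dh s) a b ab.
rewrite !fctE /GRing.scale/= => Hm Hp; rewrite ler_norml; apply/andP; split.
  suff : c * a + h a <= c * b + h b by lra.
  apply: Hp => s sab; first by have := hd s sab => ?; exact: is_deriveD.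
  by have := dhc s sab; rewrite ler_norml => /andP[? _]; lra.
suff : c * a - h a <= c * b - h b by lra.
apply: Hm => s sab; first by have := hd s sab => ?; exact: is_deriveB.
by have := dhc s sab; rewrite ler_norml => /andP[_ ?]; lra.
Qed.

Lemma derivative_bound_affine {h dh} c {t} : 0 <= t ->
  (forall s, 0 <= s <= t -> is_derive s 1 h (dh s)) ->
  (forall s, 0 <= s <= t -> `|dh s| <= c) -> `|h t - h 0| <= c * t.
Proof.
by move=> t0 hd dhc; have := mean_value_bound c t0 hd dhc; rewrite subr0.
Qed.

Lemma taylor2_bound {h dh ddh} c {t} : 0 <= t ->
  (forall s, 0 <= s <= t -> is_derive s 1 h (dh s)) ->
  (forall s, 0 <= s <= t -> is_derive s 1 dh (ddh s)) ->
  (forall s, 0 <= s <= t -> `|ddh s| <= c) ->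
  `|h t - h 0 - dh 0 * t| <= c / 2 * t ^+ 2.
Proof.
move=> t0 hd dhd ddc.
apply: (@derivative_bound R (fun s => h s - h 0 - dh 0 * s)
  (fun s => dh s - dh 0) (fun s => c / 2 * s ^+ 2) (fun s => c * s)) => //.
- move=> s st; have H := hd s st.
  apply: (@is_derive_eq _ _ _ (h - cst (h 0) - dh 0 \*: (@id R)) ) => //.
  by rewrite /GRing.scale/= mulr1 subr0.
- move=> s st; apply: (@is_derive_eq _ _ _ ((c / 2) \*: (fun s => s ^+ 2))).
  by rewrite /GRing.scale/=; field.
- move=> s /andP[s0 st]; apply: (derivative_bound_affine _ s0) => r /andP[r0 rs].
    by apply: dhd; rewrite r0 (le_trans rs).
  by apply: ddc; rewrite r0 (le_trans rs).
- by rewrite !mulr0 !subr0 subrr normr0 expr0n/= mulr0.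
Qed.

Lemma weighted_bound1 {h dh} c m {t} : 0 <= t -> 0 < m -> 0 <= c -> h 0 = 0 ->
  (forall s, 0 <= s <= t -> is_derive s 1 h (dh s)) ->
  (forall s, 0 <= s <= t -> `|dh s| <= c * expR (m * s)) ->
  `|h t| <= c / m * expR (m * t).
Proof.
move=> t0 m0 c0 h0 hd dhc.
apply: (@derivative_bound R h dh (fun s => c / m * expR (m * s))
  (fun s => c * expR (m * s)) t t0 hd) => //.
  move=> s st.
  have H : is_derive s 1 (fun s => expR (m * s)) (m * expR (m * s)).
    have -> : (fun s => expR (m * s)) = expR \o (m \*: (@id R)) by [].
    apply: is_derive_eq; rewrite /GRing.scale/= mulr1 mulrC; reflexivity.
  apply: (@is_derive_eq _ _ _ ((c / m) \*: (fun s => expR (m * s)))).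
  by rewrite /GRing.scale/=; field; rewrite gt_eqF.
by rewrite h0 normr0 mulr_ge0 ?expR_ge0 ?divr_ge0 ?(ltW m0).
Qed.

(** Integrating twice against the weight [expR (m s)] gains a factor [m^-2]. *)
Lemma weighted_bound {h dh ddh} c m {t} :
  0 <= t -> 0 < m -> 0 <= c -> h 0 = 0 -> dh 0 = 0 ->
  (forall s, 0 <= s <= t -> is_derive s 1 h (dh s)) ->
  (forall s, 0 <= s <= t -> is_derive s 1 dh (ddh s)) ->
  (forall s, 0 <= s <= t -> `|ddh s| <= c * expR (m * s)) ->
  `|h t| <= c / m ^+ 2 * expR (m * t).
Proof.
move=> t0 m0 c0 h0 dh0 hd dhd ddc; rewrite expr2 invfM mulrA.
apply: (weighted_bound1 _ _ t0 m0 _ h0 hd); first by rewrite divr_ge0 ?(ltW m0).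
move=> s /andP[s0 st]; apply: (weighted_bound1 _ _ s0 m0 c0 dh0).
  by move=> r /andP[r0 rs]; apply: dhd; rewrite r0 (le_trans rs).
by move=> r /andP[r0 rs]; apply: ddc; rewrite r0 (le_trans rs).
Qed.

End derivative_bounds.

Section dyadic.
Context {R : realType}.

Lemma dyadic_le0 (x c : R) : (forall k, x <= c * 2^-1 ^+ k) -> x <= 0.
Proof.
move=> xc; rewrite leNgt; apply/negP => x0.
have c0 : 0 < c by have := xc 0; rewrite expr0 mulr1; exact: lt_le_trans.
have := archi_boundP (ltW (divr_gt0 c0 x0)).
set N := Num.bound _; rewrite ltr_pdivrMr// => cN.
have := xc N; rewrite exprVn ler_pdivlMr ?exprn_gt0// leNgt => /negP; apply.
rewrite (lt_le_trans cN)// mulrC ler_pM2l// -natrX ler_nat.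
exact/ltnW/ltn_expl.
Qed.

(** A sequence with dyadic increments converges; the limit is the supremum of
    the lower bounds [u k - 2 c 2^-k]. *)
Lemma dyadic_limit (u : nat -> R) (c : R) :
  (forall k, `|u k.+1 - u k| <= c * 2^-1 ^+ k) ->
  exists l, forall k, `|u k - l| <= 2 * c * 2^-1 ^+ k.
Proof.
move=> uc; pose x k := u k - 2 * c * 2^-1 ^+ k.
pose y k := u k + 2 * c * 2^-1 ^+ k.
have c0 : 0 <= c by have := uc 0; rewrite expr0 mulr1; exact: le_trans.
have q0 k : 0 <= 2 * c * 2^-1 ^+ k :> R by rewrite !mulr_ge0// exprn_ge0.
have xS k : x k <= x k.+1.
  by have := uc k; rewrite /x exprS ler_norml => /andP[? _]; lra.
have yS k : y k.+1 <= y k.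
  by have := uc k; rewrite /y exprS ler_norml => /andP[_ ?]; lra.
have xm k m : (k <= m)%N -> x k <= x m.
  by move=> /subnK <-; elim: (m - k)%N => // d IH; rewrite (le_trans IH)// addSn.
have ym k m : (k <= m)%N -> y m <= y k.
  by move=> /subnK <-; elim: (m - k)%N => // d IH; rewrite (le_trans _ IH)// addSn.
have xy k m : x k <= y m.
  apply: le_trans (xm _ _ (leq_maxl k m)) (le_trans _ (ym _ _ (leq_maxr k m))).
  by rewrite /x /y; have := q0 (maxn k m); lra.
exists (sup (range x)) => k; rewrite ler_distlC -/(x k) -/(y k).
have ubx : has_sup (range x).
  by split; [exists (x 0%N), 0%N | exists (y 0%N) => _ [m _ <-]].
apply/andP; split; first by apply: ub_le_sup; [case: ubx | exists k].
by apply: ge_sup => [|_ [m _ <-]]; [case: ubx | exact: xy].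
Qed.

End dyadic.

Section classical_solutions.
Context {R : realType} {n : nat}.
Implicit Types (f : 'rV[R]_n -> 'rV[R]_n) (Y : 'rV[R]_n)
  (W V U : R -> 'rV[R]_n) (T : R).

(** [W] solves [W'' + f(W) = 0] on [0, T] with data [(Y0, Y1)], and [V = W'].
    The functions are defined on the whole line and the derivatives at the
    endpoints are two-sided. *)
Definition classical f Y0 Y1 T W V : Prop :=
  [/\ W 0 = Y0, V 0 = Y1,
      forall t : R, 0 <= t <= T -> forall j,
        is_derive t 1 (fun s => W s ord0 j) (V t ord0 j) &
      forall t : R, 0 <= t <= T -> forall j,
        is_derive t 1 (fun s => V s ord0 j) (- f (W t) ord0 j)].

Lemma classical_sub f Y0 Y1 T T' W V :
  T' <= T -> classical f Y0 Y1 T W V -> classical f Y0 Y1 T' W V.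
Proof.
move=> TT [W0 V0 dW dV]; split=> // t /andP[t0 tT]; [apply: dW|apply: dV];
  by rewrite t0 (le_trans tT).
Qed.

Lemma classical_ext f f' Y0 Y1 T W V :
  (forall t : R, 0 <= t <= T -> f (W t) = f' (W t)) ->
  classical f Y0 Y1 T W V -> classical f' Y0 Y1 T W V.
Proof. by move=> ff [W0 V0 dW dV]; split=> // t tT j; rewrite -ff//; exact: dV. Qed.

Lemma classical_bounded f Y0 Y1 T W V : 0 <= T -> classical f Y0 Y1 T W V ->
  exists r, forall t : R, 0 <= t <= T -> cube r (W t).
Proof.
move=> T0 [_ _ dW _].
have /fin_all_exists[r rP] (j : 'I_n) : exists r,
    forall t : R, 0 <= t <= T -> `|W t ord0 j| <= r.
  have [|c _ Hc] := @EVT_max R (fun s => `|W s ord0 j|) 0 T T0.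
    apply: continuous_in_subspaceT => s; rewrite inE/= in_itv/= => sT.
    by apply: continuous_comp; [exact: is_derive_continuous (dW s sT j)
                               | exact: norm_continuous].
  by exists `|W c ord0 j| => t tT; apply: Hc; rewrite in_itv.
exists (\sum_j `|r j|) => t tT j; rewrite (le_trans (rP j t tT))//.
by rewrite (bigD1 j)//= ler_wpDr ?sumr_ge0// ler_norm.
Qed.

(** With the weight exponent [L + 1], the factor [L / (L + 1)^2] produced by a
    nonlinearity of Lipschitz constant [L] is at most 1/2. *)
Lemma half_weight (L c x : R) : 0 <= L -> 0 <= c * x ->
  L * c / (L + 1) ^+ 2 * x <= c * 2^-1 * x.
Proof.
move=> L0 cx0; have m0 : 0 < (L + 1) ^+ 2 by rewrite exprn_gt0// ltr_wpDl.
have -> : L * c / (L + 1) ^+ 2 * x = c * x * L / (L + 1) ^+ 2 by ring.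
rewrite ler_pdivrMr//.
have -> : c * 2^-1 * x * (L + 1) ^+ 2 = c * x * ((L + 1) ^+ 2 / 2) by ring.
rewrite ler_wpM2l//; have := sqr_ge0 L; lra.
Qed.

(** Two solutions bounded by [r] on [0, T] differ by at most
    [2 r 2^-k expR (m t)] for every [k]. *)
Lemma classical_unique f Y0 Y1 T W V W' V' : locally_lipschitz f ->
  classical f Y0 Y1 T W V -> classical f Y0 Y1 T W' V' ->
  forall t : R, 0 <= t <= T -> W t = W' t.
Proof.
move=> fL cW cW' t0 t0T; have T0 : 0 <= T by case/andP: t0T; exact: le_trans.
have [r1 Hr1] := classical_bounded _ _ _ _ _ _ T0 cW.
have [r2 Hr2] := classical_bounded _ _ _ _ _ _ T0 cW'.
pose r := Num.max 0 (Num.max r1 r2).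
have r0 : 0 <= r by rewrite le_max lexx.
have Wr t : 0 <= t <= T -> cube r (W t).
  by move=> tT j; rewrite (le_trans (Hr1 t tT j))// !le_max lexx orbT.
have Wr' t : 0 <= t <= T -> cube r (W' t).
  by move=> tT j; rewrite (le_trans (Hr2 t tT j))// !le_max lexx !orbT.
have [L L0 HL] := fL r; pose m := L + 1.
have m0 : 0 < m by rewrite ltr_wpDl.
have [W0 V0 dW dV] := cW; have [W0' V0' dW' dV'] := cW'.
have step k : forall t : R, 0 <= t <= T -> forall j,
    `|W t ord0 j - W' t ord0 j| <= 2 * r * 2^-1 ^+ k * expR (m * t).
  elim: k => [|k IH] t tT j.
    rewrite expr0 mulr1 (le_trans (ler_normB _ _))//.
    rewrite (le_trans (lerD (Wr _ tT j) (Wr' _ tT j)))//.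
    rewrite -mulr2n -[r *+ 2]mulr_natl ler_peMr ?mulr_ge0//.
    rewrite (le_trans _ (expR_ge1Dx _))// lerDl mulr_ge0 ?(ltW m0)//.
    by case/andP: tT.
  have [t_ge0 t_le] := andP tT.
  have sT s : 0 <= s <= t -> 0 <= s <= T.
    by case/andP=> -> st; rewrite (le_trans st).
  have := @weighted_bound R (fun s => W s ord0 j - W' s ord0 j)
    (fun s => V s ord0 j - V' s ord0 j)
    (fun s => - f (W s) ord0 j - - f (W' s) ord0 j)
    (L * (2 * r * 2^-1 ^+ k)) m t t_ge0 m0.
  rewrite W0 V0 W0' V0' !subrr => /(_ _ erefl erefl) H.
  rewrite exprSr mulrA (le_trans (H _ _ _ _))//.
  - by rewrite !mulr_ge0// exprn_ge0.
  - move=> s /sT st; have := dW s st j; have := dW' s st j => ? ?.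
    exact: is_deriveB.
  - move=> s /sT st; have := dV s st j; have := dV' s st j => ? ?.
    exact: is_deriveB.
  - move=> s /sT st; rewrite opprK addrC distrC -[leRHS]mulrA.
    by apply: HL; [exact: Wr | exact: Wr' | exact: IH].
  - by rewrite /m half_weight// !mulr_ge0 ?expR_ge0// exprn_ge0.
apply/rowP => j; apply/eqP; rewrite -subr_eq0 -normr_le0.
apply: (@dyadic_le0 R _ (2 * r * expR (m * t0))) => k.
by rewrite mulrAC step.
Qed.

End classical_solutions.

(** * Picard iteration *)

Section picard.
Context {R : realType} {n : nat}.
Variables (f : 'rV[R]_n -> 'rV[R]_n) (Y0 Y1 : 'rV[R]_n) (T : R).
Hypotheses (T0 : 0 <= T) (f_loc_lip : locally_lipschitz f).
Implicit Types (U : R -> 'rV[R]_n) (s t : R).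

(** The nonlinearity along [U], frozen outside [0, T]. *)
Definition force U j s := f (U (clip 0 T s)) ord0 j.

(** The Picard map sends [U] to the solution of [W'' = - f(U)] with data
    [(Y0, Y1)]; the Picard velocity is the derivative of its value. *)
Definition picard_velocity U t : 'rV[R]_n :=
  \row_j (Y1 ord0 j - primitive (force U j) t).

Definition picard_map U t : 'rV[R]_n :=
  \row_j (Y0 ord0 j + t * Y1 ord0 j - primitive (primitive (force U j)) t).

(** Continuity of every coordinate. *)
Definition continuous_coord U := forall j, continuous (fun s => U s ord0 j).

Lemma continuous_force U j : continuous_coord (U \o clip 0 T) ->
  continuous (force U j).
Proof.
move=> cU s.
exact: (continuous_comp_lipschitz f (U \o clip 0 T) s f_loc_lip (fun i => cU i s)).
Qed.

Lemma is_derive_picard_velocity U t j : continuous_coord (U \o clip 0 T) ->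
  is_derive t 1 (fun s => picard_velocity U s ord0 j) (- force U j t).
Proof.
move=> cU; have cF := continuous_force U j cU.
have H := is_derive_primitive _ t cF.
have -> : (fun s => picard_velocity U s ord0 j) =
    cst (Y1 ord0 j) - primitive (force U j).
  by apply/funext => s; rewrite mxE.
by apply: is_derive_eq; rewrite sub0r.
Qed.

Lemma is_derive_picard_map U t j : continuous_coord (U \o clip 0 T) ->
  is_derive t 1 (fun s => picard_map U s ord0 j) (picard_velocity U t ord0 j).
Proof.
move=> cU; have cF := continuous_force U j cU.
have H := is_derive_primitive _ t (continuous_primitive _ cF).
have -> : (fun s => picard_map U s ord0 j) =
    cst (Y0 ord0 j) + Y1 ord0 j \*: (@id R) - primitive (primitive (force U j)).
  by apply/funext => s; rewrite mxE !fctE /GRing.scale/= [s * _]mulrC.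
by apply: is_derive_eq; rewrite mxE /GRing.scale/= add0r mulr1.
Qed.

Lemma picard_map0 U : picard_map U 0 = Y0.
Proof. by apply/rowP => j; rewrite mxE primitive0 mul0r addr0 subr0. Qed.

Lemma picard_velocity0 U : picard_velocity U 0 = Y1.
Proof. by apply/rowP => j; rewrite mxE primitive0 subr0. Qed.

Lemma continuous_coord_clip U : continuous_coord U ->
  continuous_coord (U \o clip 0 T).
Proof.
move=> cU j s; apply: (@continuous_comp _ _ _ (clip 0 T) (fun s => U s ord0 j)).
  exact: clip_continuous.
exact: cU.
Qed.

Lemma continuous_picard_map U : continuous_coord (U \o clip 0 T) ->
  continuous_coord (picard_map U).
Proof.
by move=> cU j s; exact: is_derive_continuous (is_derive_picard_map U s j cU).
Qed.

(** A fixed point of the Picard map on [0, T] is a classical solution. *)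
Lemma picard_fixpoint_classical U : continuous_coord (U \o clip 0 T) ->
  (forall t, 0 <= t <= T -> picard_map U t = U t) ->
  classical f Y0 Y1 T (picard_map U) (picard_velocity U).
Proof.
move=> cU fixU; split.
- exact: picard_map0.
- exact: picard_velocity0.
- by move=> t _ j; exact: is_derive_picard_map.
- move=> t tT j; rewrite fixU//.
  by have := is_derive_picard_velocity U t j cU; rewrite /force clip_id.
Qed.

End picard.

Section picard_iteration.
Context {R : realType} {n : nat}.
Variables (f : 'rV[R]_n -> 'rV[R]_n) (Y0 Y1 : 'rV[R]_n) (T L : R).
Hypotheses (T0 : 0 <= T) (L0 : 0 <= L) (fL : lipschitz_coord setT L f).
Implicit Types (U : R -> 'rV[R]_n) (s t : R).

Let f_loc_lip : locally_lipschitz f.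
Proof. by move=> r; exists L => // Y Z B _ _; exact: fL. Qed.

Local Notation pmap := (picard_map f Y0 Y1 T).
Local Notation pvel := (picard_velocity f Y1 T).
Local Notation pforce := (force f T).
Let dmap := is_derive_picard_map f Y0 Y1 T f_loc_lip.
Let dvel := is_derive_picard_velocity f Y1 T f_loc_lip.
Let contclip := @continuous_coord_clip R n T.
Let contmap := continuous_picard_map f Y0 Y1 T f_loc_lip.

(** The Picard map is a contraction for the norm with weight [expR (m t)] once
    [m] is large. *)
Lemma picard_map_dist U U' c m :
  continuous_coord (U \o clip 0 T) -> continuous_coord (U' \o clip 0 T) ->
  0 < m -> 0 <= c ->
  (forall t, 0 <= t <= T ->
     forall j, `|U t ord0 j - U' t ord0 j| <= c * expR (m * t)) ->
  forall t, 0 <= t <= T -> forall j,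
    `|pmap U t ord0 j - pmap U' t ord0 j|
      <= L * c / m ^+ 2 * expR (m * t).
Proof.
move=> cU cU' m0 c0 UU t tT j; have [t0 t_le] := andP tT.
have sT s : 0 <= s <= t -> 0 <= s <= T.
  by case/andP=> -> st; rewrite (le_trans st).
apply: (@weighted_bound R
  (fun s => pmap U s ord0 j - pmap U' s ord0 j)
  (fun s => pvel U s ord0 j - pvel U' s ord0 j)
  (fun s => - pforce U j s - - pforce U' j s)) => //.
- by rewrite mulr_ge0.
- by rewrite !picard_map0 subrr.
- by rewrite !picard_velocity0 subrr.
- by move=> s _; exact: is_deriveB (dmap _ _ _ cU)
                                   (dmap _ _ _ cU').
- by move=> s _; exact: is_deriveB (dvel _ _ _ cU)
                                   (dvel _ _ _ cU').
- move=> s /sT st; rewrite opprK addrC distrC -[leRHS]mulrA.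
  by apply: fL => // i; rewrite !clip_id// UU.
Qed.

Let iterate k := iter k pmap (fun=> Y0).

Let continuous_iterate k : continuous_coord (iterate k).
Proof.
elim: k => [|k IH]; first by move=> j s; exact: cst_continuous.
exact/contmap/contclip.
Qed.

Let m := L + 1.
Let m0 : 0 < m. Proof. by rewrite ltr_wpDl. Qed.

(** Any bound for the first increment serves as [C], since the weight is at
   least 1 on [0, T]. *)
Let iterate_dist : exists2 C : R, 0 <= C &
  forall k t, 0 <= t <= T -> forall j,
    `|iterate k.+1 t ord0 j - iterate k t ord0 j|
      <= C * 2^-1 ^+ k * expR (m * t).
Proof.
pose F := \sum_(i < n) `|f Y0 ord0 i|; pose G := \sum_(i < n) `|Y1 ord0 i|.
have F0 : 0 <= F by rewrite sumr_ge0.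
have G0 : 0 <= G by rewrite sumr_ge0.
pose C := F / 2 * T ^+ 2 + T * G.
have C0 : 0 <= C by rewrite addr_ge0 ?mulr_ge0 ?sqr_ge0.
exists C => //; elim => [|k IH] t tT j.
  have [t0 t_le] := andP tT.
  rewrite expr0 mulr1.
  apply: (@le_trans _ _ C); last first.
    rewrite ler_peMr// (le_trans _ (expR_ge1Dx _))// lerDl mulr_ge0//.
    exact: ltW.
  have cU := contclip _ (continuous_iterate 0).
  have H := @taylor2_bound R _ _ _ F _ t0
    (fun s _ => dmap _ s j cU)
    (fun s _ => dvel _ s j cU).
  have {H} := H _; rewrite picard_map0 picard_velocity0 => H.
  rewrite [X in `|X|](_ : _ =
    (pmap (iterate 0) t ord0 j - Y0 ord0 j - Y1 ord0 j * t) +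
    Y1 ord0 j * t); last by rewrite subrK.
  rewrite (le_trans (ler_normD _ _))// lerD//.
    rewrite (le_trans (H _))//.
      move=> s _; rewrite normrN /force /F (bigD1 j)//=.
      by rewrite lerDl sumr_ge0.
    by rewrite ler_wpM2l ?divr_ge0// ler_sqr ?nnegrE.
  rewrite normrM (ger0_norm t0) mulrC ler_pM//.
  by rewrite /G (bigD1 j)//= lerDl sumr_ge0.
rewrite exprSr mulrA; apply: le_trans _ (half_weight L _ _ L0 _); last first.
  by rewrite !mulr_ge0 ?expR_ge0// exprn_ge0.
apply: (picard_map_dist (iterate k.+1) (iterate k)) => //.
- exact/contclip/continuous_iterate.
- exact/contclip/continuous_iterate.
- by rewrite mulr_ge0// exprn_ge0.
Qed.

(** Picard-Lindelof for a globally Lipschitz nonlinearity. *)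
Lemma classical_exists : exists W V, classical f Y0 Y1 T W V.
Proof.
have [C C0 HC] := iterate_dist; pose E := expR (m * T).
have E0 : 0 <= E by exact: expR_ge0.
have tE t : 0 <= t <= T -> expR (m * t) <= E.
  by case/andP=> _ tT; rewrite ler_expR ler_wpM2l// ltW.
have q0 k : 0 <= 2^-1 ^+ k :> R by rewrite exprn_ge0.
have /choice[u Hu] (x : 'I_n * R) : exists l : R, forall k,
    `|iterate k (clip 0 T x.2) ord0 x.1 - l| <= 2 * (C * E) * 2^-1 ^+ k.
  apply: dyadic_limit => k; have xT := clip_in 0 T x.2 T0.
  rewrite (le_trans (HC _ _ xT _))// [leRHS]mulrAC ler_wpM2l ?tE//.
  by rewrite mulr_ge0.
pose U t : 'rV[R]_n := \row_j u (j, t).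
have HU k t j : `|iterate k (clip 0 T t) ord0 j - U t ord0 j|
    <= 2 * (C * E) * 2^-1 ^+ k.
  by rewrite mxE; exact: (Hu (j, t)).
have CE0 : 0 <= 2 * (C * E) by rewrite !mulr_ge0.
have cU : continuous_coord U.
  move=> j t; apply/cvgrPdist_le => /= e e0.
  have [k Hk] : exists k, 2 * (C * E) * 2^-1 ^+ k <= e / 3.
    apply: contrapT => /forallNP H; have : e / 3 <= 0.
      apply: (@dyadic_le0 R _ (2 * (C * E))) => k.
      by have /negP := H k; rewrite -ltNge => /ltW.
    by apply/negP; rewrite -ltNge divr_gt0.
  have := contclip _ (continuous_iterate k) j t.
  move/cvgrPdist_le => /(_ (e / 3)); rewrite divr_gt0// => /(_ isT) near_t.
  near=> s; have /= H1 : `|(iterate k \o clip 0 T) t ord0 j -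
    (iterate k \o clip 0 T) s ord0 j| <= e / 3 by near: s.
  have := le_trans (HU k t j) Hk; have := le_trans (HU k s j) Hk.
  by move: H1; rewrite !ler_norml => /andP[? ?] /andP[? ?] /andP[? ?];
    apply/andP; split; lra.
have cUc := contclip _ cU.
exists (pmap U), (pvel U).
apply: (picard_fixpoint_classical f Y0 Y1 T f_loc_lip) => // t tT; apply/rowP => j.
apply/eqP; rewrite -subr_eq0 -normr_le0.
pose D := L * (2 * (C * E)) / m ^+ 2 * expR (m * t) + 2 * (C * E).
apply: (@dyadic_le0 R _ D) => k.
have H1 : `|iterate k.+1 t ord0 j - U t ord0 j| <= 2 * (C * E) * 2^-1 ^+ k.
  have := HU k.+1 t j; rewrite clip_id// => H; apply: le_trans H _.
  rewrite ler_wpM2l// exprS ler_piMl// invf_le1 ?ltr0n//.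
  by rewrite ler1n.
have H2 : `|pmap U t ord0 j - iterate k.+1 t ord0 j|
    <= L * (2 * (C * E) * 2^-1 ^+ k) / m ^+ 2 * expR (m * t).
  apply: picard_map_dist => //.
  - exact/contclip/continuous_iterate.
  - by rewrite mulr_ge0.
  - move=> s sT i; rewrite distrC; have := HU k s i; rewrite clip_id// => H.
    apply: le_trans H _; rewrite ler_peMr// ?mulr_ge0//.
    rewrite (le_trans _ (expR_ge1Dx _))// lerDl mulr_ge0 ?(ltW m0)//.
    by case/andP: sT.
rewrite -(subrK (iterate k.+1 t ord0 j) (pmap U t ord0 j)) -addrA.
apply: le_trans (ler_normD _ _) _; apply: le_trans (lerD H2 H1) _.
rewrite /D le_eqVlt; apply/orP; left; apply/eqP; ring.
Unshelve. all: by end_near. Qed.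

End picard_iteration.

(** * Equivalence of the integral equation with the classical problem *)

Section integral_equation.
Context {R : realType}.
Notation mu := (@lebesgue_measure R).

Lemma integrable_continuousM (h g : R -> R) (a b : R) :
  {within `[a, b], continuous h} -> mu.-integrable `[a, b] (EFin \o g) ->
  mu.-integrable `[a, b] (EFin \o (fun s => h s * g s)).
Proof.
move=> ch ig.
have -> : EFin \o (fun s => h s * g s) = ((EFin \o h) \* (EFin \o g))%E.
  by apply/funext => s; rewrite /= EFinM.
apply: integrableMr => //; first exact: subspace_continuous_measurable_fun.
have /compact_bounded[M [_ mrt]] := continuous_compact ch (@segment_compact R a b).
by exists M; split; rewrite ?num_real// => x Mx y yab; apply: mrt => //; exists y.
Qed.

Lemma time_interval_lt (T : \bar R) t : time_interval T t ->
  exists2 u, t < u & time_interval T u.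
Proof.
case=> t0; case: T => [r||//]; rewrite ?lte_fin => tT.
  exists ((t + r) / 2); first by lra.
  by split; rewrite ?lte_fin; lra.
by exists (t + 1); [rewrite ltrDl | split; rewrite ?ltry// addr_ge0].
Qed.

Lemma time_interval_le (T T' : \bar R) t :
  (T <= T')%E -> time_interval T t -> time_interval T' t.
Proof. by move=> TT [t0 tT]; split=> //; exact: lt_le_trans TT. Qed.

Lemma time_interval_sub (T : \bar R) s t :
  time_interval T t -> 0 <= s <= t -> time_interval T s.
Proof. by move=> [_ tT] /andP[s0 st]; split=> //; exact: le_lt_trans tT. Qed.

Context {n : nat} (f : 'rV[R]_n -> 'rV[R]_n) (rho0 rho1 : R -> R) (T1 : \bar R).
Hypotheses (f_lip : locally_lipschitz f)
  (rho0E : forall t, time_interval T1 t -> rho0 t = 1)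
  (rho1E : forall t, time_interval T1 t -> rho1 t = t).
Variables (Y0 Y1 : 'rV[R]_n).
Implicit Types (Y Z W V : R -> 'rV[R]_n) (T : \bar R).

Let rho12E s t : time_interval T1 t -> 0 <= s <= t -> rho12 rho0 rho1 t s = t - s.
Proof.
move=> tT st; have sT := time_interval_sub _ _ _ tT st.
by rewrite /rho12 !rho0E// !rho1E// mul1r mulr1 addrC.
Qed.

Let integrandE s t : time_interval T1 t -> s \in `[0, t]%classic ->
  rho12 rho0 rho1 t s = t - s.
Proof. by move=> tT; rewrite inE/= in_itv/= => st; rewrite rho12E. Qed.

Let within_affine (a b c : R) : {within `[a, b], continuous (fun s : R => c - s)}.
Proof.
apply: continuous_subspaceT => s.
by apply: continuousB; [exact: cst_continuous | exact: cvg_id].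
Qed.

(** A function that is locally a classical solution solves the integral
    equation. *)
Lemma classical_solution Y T : (T <= T1)%E ->
  (forall t, time_interval T t -> exists W V,
     classical f Y0 Y1 t W V /\ forall s, 0 <= s <= t -> W s = Y s) ->
  solution rho0 rho1 f Y0 Y1 T Y.
Proof.
move=> TT HY t tT; have tT1 := time_interval_le _ _ _ TT tT.
have [t0 _] := tT; have [W [V [cW WY]]] := HY t tT.
have [W0 V0 dW dV] := cW.
have gE s : s \in `[0, t]%classic -> W s = Y s.
  by rewrite inE/= in_itv/= => st; rewrite WY.
have cf j : {within `[0, t], continuous (fun s => f (W s) ord0 j)}.
  apply: continuous_in_subspaceT => s; rewrite inE/= in_itv/= => st.
  apply: continuous_comp_lipschitz => // i.
  exact: is_derive_continuous (dW s st i).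
split=> [j|].
  have : mu.-integrable `[0, t] (EFin \o (fun s => (t - s) * f (W s) ord0 j)).
    apply: integrable_continuousM; first exact: within_affine.
    by apply: continuous_compact_integrable => //; exact: segment_compact.
  apply: eq_integrable => //.
  by move=> s st /=; rewrite gE// integrandE.
apply/rowP => j; rewrite mxE -WY ?t0 ?lexx//.
rewrite (@eq_Rintegral _ _ _ mu `[0, t]
  (fun s => (t - s) * f (W s) ord0 j)); last first.
  by move=> s st /=; rewrite gE// integrandE.
rewrite rho0E// rho1E// mul1r.
have -> := @taylor2_integral R (fun s => W s ord0 j) (fun s => V s ord0 j)
  _ t t0 (fun s st => dW s st j) (fun s st => dV s st j) (cf j).
by rewrite W0 V0.
Qed.

(** Conversely a solution of the integral equation is classical on every compact
    subinterval.  The weight [t2 - s], evaluated at some later time [t2], is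
    bounded away from 0 on [0, t], so that [f(Y)] is integrable there; then the
    integral equation shows that [Y] is continuous. *)
Lemma solution_classical Y T t : (T <= T1)%E ->
  solution rho0 rho1 f Y0 Y1 T Y -> time_interval T t ->
  exists W V, classical f Y0 Y1 t W V /\ forall s, 0 <= s <= t -> W s = Y s.
Proof.
move=> TT solY tT; have [t0 _] := tT.
have [t2 tt2 t2T] := time_interval_lt _ _ tT.
have [t20 _] := t2T; have t2T1 := time_interval_le _ _ _ TT t2T.
pose g j s := f (Y s) ord0 j.
have ig j : mu.-integrable `[0, t] (EFin \o g j).
  have [/(_ j) i2 _] := solY t2 t2T.
  have i1 : mu.-integrable `[0, t] (EFin \o (fun s => (t2 - s) * g j s)).
    have sub : `[0, t] `<=` `[0, t2].
      by apply: subset_itvl; rewrite bnd_simp ltW.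
    suff : mu.-integrable `[0, t2] (EFin \o (fun s => (t2 - s) * g j s)).
      exact: integrableS.
    apply: eq_integrable i2 => //.
    by move=> s st /=; rewrite integrandE.
  have : mu.-integrable `[0, t]
      (EFin \o (fun s => (t2 - s)^-1 * ((t2 - s) * g j s))).
    apply: integrable_continuousM i1.
    apply: continuous_in_subspaceT => s; rewrite inE/= in_itv/= => /andP[_ st].
    apply: (@continuousV _ _ (fun s => t2 - s)).
      by rewrite subr_eq0 gt_eqF// (le_lt_trans st).
    by apply: continuousB; [exact: cst_continuous | exact: cvg_id].
  apply: eq_integrable => // s; rewrite inE/= in_itv/= => /andP[_ st].
  by rewrite mulKf// subr_eq0 gt_eqF// (le_lt_trans st).
have isg j : mu.-integrable `[0, t] (EFin \o (fun s => s * g j s)).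
  apply: integrable_continuousM (ig j).
  by apply: continuous_subspaceT => s; exact: cvg_id.
have YE j s : s \in `[0, t]%classic -> Y s ord0 j =
    Y0 ord0 j + s * Y1 ord0 j - (s * (\int[mu]_(r in `[0, s]) g j r)
      - \int[mu]_(r in `[0, s]) (r * g j r)).
  rewrite inE/= in_itv/= => st.
  have sT := time_interval_sub _ _ _ tT st.
  have sT1 := time_interval_le _ _ _ TT sT.
  have sub : `[0, s] `<=` `[0, t].
    by apply: subset_itvl; rewrite bnd_simp; case/andP: st.
  have igs : mu.-integrable `[0, s] (EFin \o g j) by exact: integrableS (ig j).
  have isgs : mu.-integrable `[0, s] (EFin \o (fun r => r * g j r)).
    exact: integrableS (isg j).
  have [_ ->] := solY s sT; rewrite mxE rho0E// rho1E// mul1r.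
  congr (_ - _); rewrite -RintegralZl// -RintegralB//; last first.
    apply: (integrable_continuousM (fun=> s)) => //.
    exact: continuous_subspaceT (@cst_continuous _ _ s).
  by apply: eq_Rintegral => r rs; rewrite integrandE// mulrBl.
have cY j : {within `[0, t], continuous (fun s => Y s ord0 j)}.
  have cid : {within `[0, t], continuous (@id R)}.
    by apply: continuous_subspaceT => s; exact: cvg_id.
  have cc (c : R) : {within `[0, t], continuous (fun=> c)}.
    exact: continuous_subspaceT (@cst_continuous _ _ c).
  apply: (@subspace_eq_continuous R `[0, t]%classic R
    (fun s => Y0 ord0 j + s * Y1 ord0 j
      - (s * (\int[mu]_(r in `[0, s]) g j r)
        - \int[mu]_(r in `[0, s]) (r * g j r)))).
    by move=> s st; exact: esym (YE j s st).
  have cP := parameterized_integral_continuous t0 (ig j).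
  have cQ := parameterized_integral_continuous t0 (isg j).
  apply: within_continuousB.
    apply: within_continuousD; first exact: cc.
    by move=> s; apply: (@continuousM R (subspace `[0, t])); [exact: cid | exact: cc].
  apply: within_continuousB => //.
  by move=> s; apply: (@continuousM R (subspace `[0, t])); [exact: cid | exact: cP].
have cYc : continuous_coord (Y \o clip 0 t) by move=> j; exact: continuous_clip (cY j).
have fixY s : 0 <= s <= t -> picard_map f Y0 Y1 t Y s = Y s.
  move=> st; have sT := time_interval_sub _ _ _ tT st.
  have sT1 := time_interval_le _ _ _ TT sT; have [s0 s_le] := andP st.
  have [_ ->] := solY s sT; apply/rowP => j; rewrite [RHS]mxE rho0E// rho1E// mul1r.
  have -> := @taylor2_integral R (fun s => picard_map f Y0 Y1 t Y s ord0 j)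
    (fun s => picard_velocity f Y1 t Y s ord0 j) _ s s0
    (fun r _ => is_derive_picard_map _ _ _ _ f_lip Y r j cYc)
    (fun r _ => is_derive_picard_velocity _ _ _ f_lip Y r j cYc)
    (continuous_subspaceT (continuous_force _ _ f_lip _ j cYc)).
  rewrite picard_map0 picard_velocity0; congr (_ - _).
  apply: eq_Rintegral => r; rewrite inE/= in_itv/= => /andP[r0 rs].
  by rewrite rho12E ?r0// /force clip_id// r0 (le_trans rs).
exists (picard_map f Y0 Y1 t Y), (picard_velocity f Y1 t Y).
by split=> //; exact: picard_fixpoint_classical.
Qed.

Lemma solution_unique Y Z T : (T <= T1)%E ->
  solution rho0 rho1 f Y0 Y1 T Y -> solution rho0 rho1 f Y0 Y1 T Z ->
  {in time_interval T, Z =1 Y}.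
Proof.
move=> TT sY sZ t; rewrite inE => tT; have [t0 _] := tT.
have [W [V [cW WY]]] := solution_classical _ _ _ TT sY tT.
have [W' [V' [cW' WZ]]] := solution_classical _ _ _ TT sZ tT.
have tt : 0 <= t <= t by rewrite t0 lexx.
by rewrite -WY// -WZ// (classical_unique _ _ _ _ _ _ _ _ f_lip cW' cW).
Qed.

End integral_equation.

(** * The potential vanishes *)

Section one_sided_derivatives.
Context {R : realType}.
Implicit Types (h g : R -> R) (D : set R) (t l c : R).

(** The epsilon-delta forms of the one-sided and of the two-sided derivative. *)
Lemma is_deriv_inP D h g : is_deriv_in D h g <->
  forall t, D t -> forall e, 0 < e -> exists2 d : R, 0 < d &
    forall s, D s -> s != t -> `|s - t| < d ->
      `|g t - (h s - h t) / (s - t)| <= e.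
Proof.
split=> H t Dt.
  move=> e e0; have /cvgrPdist_le/(_ e e0) := H t Dt.
  move=> /nbhs_ballP[d d0 Hd]; exists d => // s Ds st sd; apply: Hd => //.
  by rewrite /ball/= distrC.
apply/cvgrPdist_le => e e0; have [d d0 Hd] := H t Dt e e0.
apply/nbhs_ballP; exists d => // s; rewrite /ball/= distrC => sd st Ds.
exact: Hd.
Qed.

Lemma is_deriveP h t l : is_derive t 1 h l <->
  forall e, 0 < e -> exists2 d : R, 0 < d &
    forall s, s != t -> `|s - t| < d -> `|l - (h s - h t) / (s - t)| <= e.
Proof.
split=> [[dh <-] e e0|H].
  have /cvgrPdist_le/(_ e e0) := dh.
  move=> /nbhs_ballP[d d0 Hd]; exists d => // s st sd.
  have := Hd (s - t); rewrite /ball/= sub0r normrN => /(_ sd).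
  rewrite subr_eq0 => /(_ st).
  by rewrite /GRing.scale/= mulr1 subrK mulrC.
have C : (fun k => k^-1 *: ((h \o shift t) (k *: 1) - h t)) @ 0^' --> l.
  apply/cvgrPdist_le => e e0; have [d d0 Hd] := H e e0.
  apply/nbhs_ballP; exists d => // k; rewrite /ball/= sub0r normrN => kd k0.
  have := Hd (k + t); rewrite addrK -subr_eq0 addrK => /(_ k0 kd).
  by rewrite /GRing.scale/= mulr1 mulrC.
by apply: DeriveDef; [exact: cvgP C | exact: cvg_lim C].
Qed.

Lemma is_derive_is_deriv_in D h k g : {in D, h =1 k} ->
  (forall t, D t -> is_derive t 1 k (g t)) -> is_deriv_in D h g.
Proof.
move=> hk dk; apply/is_deriv_inP => t Dt e e0.
have /is_deriveP/(_ e e0)[d d0 Hd] := dk t Dt; exists d => // s Ds st sd.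
by rewrite !hk ?inE//; exact: Hd.
Qed.

Lemma time_interval_nbhs (T : \bar R) t : time_interval T t -> 0 < t ->
  exists2 d : R, 0 < d & forall s, `|s - t| < d -> time_interval T s.
Proof.
move=> tT t0; have [u tu [_ uT]] := time_interval_lt _ _ tT.
exists (Num.min t (u - t)); first by rewrite lt_min t0 subr_gt0.
move=> s; rewrite lt_min !ltr_norml => /andP[/andP[? _] /andP[_ ?]].
split; first by lra.
by apply: lt_trans uT; rewrite lte_fin; lra.
Qed.

Lemma is_deriv_in_interior T h g t :
  is_deriv_in (time_interval T) h g -> time_interval T t -> 0 < t ->
  is_derive t 1 h (g t).
Proof.
move=> /is_deriv_inP H tT t0; apply/is_deriveP => e e0.
have [d d0 Hd] := H t tT e e0; have [d' d'0 Hd'] := time_interval_nbhs _ _ tT t0.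
exists (Num.min d d'); first by rewrite lt_min d0.
by move=> s st; rewrite lt_min => /andP[sd /Hd' sT]; exact: Hd.
Qed.

Lemma is_deriv_in_continuous D h g a b : `[a, b] `<=` D ->
  is_deriv_in D h g -> {within `[a, b], continuous h}.
Proof.
move=> sD /is_deriv_inP H; apply/subspace_continuousP => t tab.
apply/cvgrPdist_le => e e0; have [d d0 Hd] := H t (sD _ tab) 1 ltr01.
pose k := `|g t| + 1; have k0 : 0 < k by rewrite ltr_wpDl.
apply/nbhs_ballP; exists (Num.min d (e / k)); first by rewrite /= lt_min d0 divr_gt0.
move=> s; rewrite /ball/= lt_min distrC => /andP[sd sk] sab.
have [->|st] := eqVneq s t; first by rewrite subrr normr0 ltW.
have := Hd s (sD _ sab) st sd.
rewrite ler_norml => /andP[H1 H2].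
have st0 : 0 < `|s - t| by rewrite normr_gt0 subr_eq0.
have : `|(h s - h t) / (s - t)| <= k.
  have := ler_norm (g t); have := ler_norm (- g t); rewrite normrN /k => ? ?.
  by rewrite ler_norml; apply/andP; split; lra.
rewrite normrM normfV ler_pdivrMr// distrC => /le_trans; apply.
by rewrite mulrC -ler_pdivlMr// ltW.
Qed.

Lemma is_deriv_in_affine T h g c : is_deriv_in (time_interval T) h g ->
  (forall t, time_interval T t -> g t = c) ->
  forall t, time_interval T t -> h t = h 0 + c * t.
Proof.
move=> hg gc t tT; have [t0 _] := tT.
have sub : `[0, t] `<=` time_interval T.
  by move=> s; rewrite /= in_itv/=; exact: (time_interval_sub _ _ _ tT).
have [s||x xt] := @MVT_segment R h g 0 t t0.
- rewrite in_itv/= => /andP[s0 st].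
  apply: (is_deriv_in_interior _ _ _ _ hg _ s0).
  by apply: (time_interval_sub _ _ _ tT); rewrite !ltW.
- exact: is_deriv_in_continuous hg.
- rewrite (gc x) ?subr0; last exact: sub.
  by move=> /eqP; rewrite subr_eq addrC => /eqP.
Qed.

End one_sided_derivatives.

Section vanishing_potential.
Context {R : realType} {n : nat} {a0 a1 sigma : R}.
Hypotheses (n_gt0 : (1 <= n)%N) (a0_gt0 : 0 < a0)
  (hcase : a1 = 0 \/ (a1 <> 0 /\ sigma = -1 + 2 / n%:R)).

Let n_neq0 : n%:R != 0 :> R. Proof. by rewrite pnatr_eq0 -lt0n. Qed.

Lemma T_1_cases : (a1 < 0 /\ T_1 n a0 a1 sigma = (- (a0 / a1))%:E) \/
  (0 <= a1 /\ T_1 n a0 a1 sigma = +oo%E).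
Proof.
rewrite /T_1 /T_0; case: hcase => [->|[/eqP a1n ->]].
  by right; rewrite mulr0 ltxx.
have -> : 1 + (-1 + 2 / n%:R) = 2 / n%:R :> R by ring.
have n0 : 0 < 2 / n%:R :> R by rewrite divr_gt0// ltr0n.
rewrite pmulr_rlt0//; have [a10|a10] := ltP a1 0; [left|right; by []].
by split=> //; congr EFin; field; rewrite n_neq0 a1n.
Qed.

(** In the cases considered the exponent of the scale factor is 1, or the scale
    factor is constant; either way it is affine. *)
Lemma scale_functionE t : 0 < a0 + a1 * t ->
  scale_function n a0 a1 sigma t = a0 + a1 * t.
Proof.
rewrite /scale_function; case: hcase => [->|[/eqP a1n ->]] pos.
  rewrite mul0r mul0r expR0 mulr1 mulr0 mul0r mul0r addr0 powR1 mulr1 addr0.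
  by case: ifP.
have n0 : 0 < 2 / n%:R :> R by rewrite divr_gt0// ltr0n.
rewrite ifF; last by apply/negbTE; rewrite -subr_eq0; apply/eqP; lra.
have -> : 2 / (n%:R * (1 + (-1 + 2 / n%:R))) = 1 :> R.
  field; rewrite n_neq0/=; apply/eqP; lra.
have E : a0 * (1 + n%:R * (1 + (-1 + 2 / n%:R)) * a1 * t / (2 * a0)) = a0 + a1 * t.
  by field; rewrite n_neq0 gt_eqF.
by rewrite powRr1// -(pmulr_rge0 _ a0_gt0) E ltW.
Qed.

Let affine_near t : 0 < a0 + a1 * t -> \forall s \near t, 0 < a0 + a1 * s.
Proof.
move=> pos; have : {for t, continuous (fun s : R => a0 + a1 * s)}.
  apply: continuousD; first exact: cst_continuous.
  by apply: continuousM; [exact: cst_continuous | exact: cvg_id].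
by move=> /(_ [set x | 0 < x]); apply; exact: lt_nbhsr.
Qed.

Let is_derive_affine (t : R) : is_derive t 1 (fun s : R => a0 + a1 * s) a1.
Proof.
have -> : (fun s : R => a0 + a1 * s) = cst a0 + a1 \*: (@id R) by [].
by apply: is_derive_eq; rewrite add0r /GRing.scale/= mulr1.
Qed.

Lemma q_0E t : 0 < a0 + a1 * t ->
  q_0 n a0 a1 sigma t = 2 * a1 / (a0 + a1 * t).
Proof.
move=> pos; rewrite /q_0 scale_functionE// derive1E.
rewrite (@near_eq_derive _ _ _ _ (fun s => (a0 + a1 * s) ^+ 2)); last first.
  by near=> s; rewrite scale_functionE//; near: s; exact: affine_near.
have -> : 'D_1 (fun s => (a0 + a1 * s) ^+ 2) t = (a0 + a1 * t) * 2 * a1.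
  have H := is_derive_affine t.
  have -> : (fun s => (a0 + a1 * s) ^+ 2) = (fun s : R => a0 + a1 * s) ^+ 2 by [].
  by rewrite derive_val /GRing.scale/=; ring.
by field; rewrite gt_eqF.
Unshelve. all: by end_near. Qed.

Lemma potential_eq0 t : time_interval (T_1 n a0 a1 sigma) t ->
  potential n a0 a1 sigma t = 0.
Proof.
case=> t0 tT; have pos : 0 < a0 + a1 * t.
  case: T_1_cases tT => -[a10 ->].
    rewrite lte_fin -mulNr ltr_ndivlMr// => ?; lra.
  by move=> _; rewrite ltr_wpDr// mulr_ge0.
rewrite /potential q_0E// derive1E.
rewrite (@near_eq_derive _ _ _ _ (fun s => 2 * a1 / (a0 + a1 * s))); last first.
  by near=> s; rewrite q_0E//; near: s; exact: affine_near.
have H := is_derive_affine t.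
have -> : (fun s => 2 * a1 / (a0 + a1 * s)) =
  (2 * a1) \*: (fun s : R => (a0 + a1 * s)^-1) by [].
have pos' : a0 + a1 * t != 0 by rewrite gt_eqF.
rewrite deriveZ/=; last exact: derivableV.
rewrite deriveV// derive_val /GRing.scale/=.
by field; rewrite gt_eqF.
Unshelve. all: by end_near. Qed.

(** Hence the fundamental solutions are [rho0 = 1] and [rho1 = t]. *)
Lemma linear_ivp_affine r0 r1 rho :
  linear_ivp (time_interval (T_1 n a0 a1 sigma)) (potential n a0 a1 sigma) r0 r1 rho ->
  forall t, time_interval (T_1 n a0 a1 sigma) t -> rho t = r0 + r1 * t.
Proof.
case=> rho' [drho drho' <- r1E] t tT; apply: (is_deriv_in_affine _ _ _ _ drho _ _ tT).
move=> s sT; rewrite -[RHS]addr0 -[X in _ + X](mul0r s) -r1E.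
apply: (is_deriv_in_affine _ _ _ _ drho' _ _ sT) => u uT.
by rewrite potential_eq0// mul0r oppr0.
Qed.

End vanishing_potential.

(** * A priori bounds and membership in the solution space *)

Section bounded_solutions.
Context {R : realType} {n : nat}.
Notation mu := (@lebesgue_measure R).
Implicit Types (Y : 'rV[R]_n) (W V : R -> 'rV[R]_n) (T r : R).

Section small_data.
Context {p K : R} (f : 'rV[R]_n -> 'rV[R]_n).
Hypotheses (n_gt0 : (1 <= n)%N) (p1 : 1 < p) (K0 : 0 <= K)
  (f_lip : locally_lipschitz f)
  (f_le : forall Y r, 0 <= r -> cube r Y -> forall j, `|f Y ord0 j| <= K * r `^ p).

(** Solutions with data small compared to a radius [r] stay in the ball of
    radius [r] up to time [T].  The truncated nonlinearity is bounded by
    [K r^p] everywhere, so the bound is a priori for the truncated problem. *)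
Lemma small_classical Y0 Y1 r T : 0 < r -> 0 <= T ->
  2 * enorm Y0 <= r -> 4 * T * enorm Y1 <= r ->
  2 * n%:R * K * r `^ (p - 1) * T ^+ 2 <= 1 ->
  exists W V, [/\ classical f Y0 Y1 T W V,
    forall t, 0 <= t <= T -> enorm (W t) <= r &
    forall t, 0 <= t <= T -> forall j,
      `|V t ord0 j - Y1 ord0 j| <= K * r `^ p * t].
Proof.
move=> r0 T0 Y0r Y1r small.
have [L L0 HL] := truncate_lipschitz f r (ltW r0) f_lip.
have [W [V cW]] := classical_exists _ Y0 Y1 T L T0 L0 HL.
have [W0 V0 dW dV] := cW; pose M := K * r `^ p.
have M0 : 0 <= M by rewrite mulr_ge0// powR_ge0.
have ddM s j : `|- f (truncate r (W s)) ord0 j| <= M.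
  by rewrite normrN f_le ?(ltW r0)//; exact/truncate_cube/ltW.
have sT s t : 0 <= t <= T -> 0 <= s <= t -> 0 <= s <= T.
  by case/andP=> _ tT /andP[-> st]; rewrite (le_trans st).
have Wr t : 0 <= t <= T -> enorm (W t) <= r.
  move=> tT; have [t0 t_le] := andP tT.
  (* From [W = Y0 + t Y1 + z] follows [|W|^2 <= 2 |Y0|^2 + 4 t^2 |Y1|^2 + 4 |z|^2],
     where the three terms are at most 1/2, 1/4 and 1/4 of [r^2]. *)
  pose z j := W t ord0 j - Y0 ord0 j - Y1 ord0 j * t.
  have zM j : `|z j| <= M / 2 * t ^+ 2.
    rewrite /z -{1}W0 -V0; apply: (@taylor2_bound R (fun s => W s ord0 j)
      (fun s => V s ord0 j)) => // s st.
    - by apply: dW; exact: sT st.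
    - by apply: dV; exact: sT st.
    - exact: ddM.
  rewrite le_enorm ?(ltW r0)//.
  apply: (@le_trans _ _ (\sum_(j < n) (2 * Y0 ord0 j ^+ 2 +
     4 * t ^+ 2 * Y1 ord0 j ^+ 2 + 4 * z j ^+ 2))).
    apply: ler_sum => j _.
    have -> : W t ord0 j = Y0 ord0 j + t * Y1 ord0 j + z j by rewrite /z; ring.
    have := sqr_ge0 (Y0 ord0 j - (t * Y1 ord0 j + z j)).
    have := sqr_ge0 (t * Y1 ord0 j - z j); lra.
  rewrite !big_split/= -!mulr_sumr -!sqr_enorm.
  have y0 := enorm_ge0 Y0; have y1 := enorm_ge0 Y1.
  have B0 : 2 * enorm Y0 ^+ 2 <= r ^+ 2 / 2.
    have : (2 * enorm Y0) ^+ 2 <= r ^+ 2.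
      by rewrite ler_sqr ?nnegrE ?mulr_ge0 ?(ltW r0).
    by lra.
  have B1 : 4 * t ^+ 2 * enorm Y1 ^+ 2 <= r ^+ 2 / 4.
    have : (4 * t * enorm Y1) ^+ 2 <= r ^+ 2.
      rewrite ler_sqr ?nnegrE ?mulr_ge0 ?(ltW r0)//.
      by rewrite (le_trans _ Y1r)// ler_wpM2r// ler_wpM2l.
    by lra.
  have B2 : \sum_(j < n) z j ^+ 2 <= r ^+ 2 / 16.
    apply: le_trans (sum_sqr_le _ _ zM) _.
    have Mt : n%:R * (M * t ^+ 2) <= r / 2.
      apply: (@le_trans _ _ (n%:R * (M * T ^+ 2))).
        by rewrite ler_wpM2l// ler_wpM2l// ler_sqr ?nnegrE.
      rewrite /M -(mulr_powRB1 (ltW r0) (lt_trans ltr01 p1)).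
      have -> : n%:R * (K * (r * r `^ (p - 1)) * T ^+ 2) =
        r / 2 * (2 * n%:R * K * r `^ (p - 1) * T ^+ 2) by field.
      by rewrite ler_piMr// divr_ge0 ?(ltW r0).
    have n1 : 1 <= n%:R :> R by rewrite ler1n.
    have Mt0 : 0 <= M * t ^+ 2 by rewrite mulr_ge0 ?sqr_ge0.
    apply: (@le_trans _ _ ((n%:R * (M * t ^+ 2)) ^+ 2 / 4)).
      have -> : n%:R * (M / 2 * t ^+ 2) ^+ 2 = n%:R * (M * t ^+ 2) ^+ 2 / 4.
        by field.
      rewrite ler_wpM2r ?invr_ge0// [leRHS]exprMn ler_wpM2r ?sqr_ge0//.
      by rewrite expr2 ler_peMl.
    have : (n%:R * (M * t ^+ 2)) ^+ 2 <= (r / 2) ^+ 2.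
      by rewrite ler_sqr ?nnegrE// ?divr_ge0 ?(ltW r0)// mulr_ge0.
    by lra.
  by lra.
exists W, V; split=> //.
  apply: classical_ext cW => t tT /=; rewrite truncate_id// => j.
  by rewrite (le_trans (coord_le_enorm _ _))// Wr.
move=> t tT j; have [t0 t_le] := andP tT; rewrite -V0.
apply: (@derivative_bound_affine R (fun s => V s ord0 j)) => // s st.
  by apply: dV; exact: sT st.
exact: ddM.
Qed.

End small_data.

Section membership.
Variables (f : 'rV[R]_n -> 'rV[R]_n) (Y0 Y1 : 'rV[R]_n) (T : R)
  (W V : R -> 'rV[R]_n).
Hypotheses (T0 : 0 < T) (cW : classical f Y0 Y1 T W V).

Let dW t : 0 <= t <= T -> forall j,
  is_derive t 1 (fun s => W s ord0 j) (V t ord0 j).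
Proof. by have [_ _ + _] := cW => H tT j; exact: H. Qed.

Let contW t : 0 <= t <= T -> forall j, {for t, continuous (fun s => W s ord0 j)}.
Proof. by move=> tT j; exact: is_derive_continuous (dW t tT j). Qed.

Let contV t : 0 <= t <= T -> forall j, {for t, continuous (fun s => V s ord0 j)}.
Proof.
by have [_ _ _ dV] := cW => tT j; exact: is_derive_continuous (dV t tT j).
Qed.

Let Linfty_le_bound (Z : R -> 'rV[R]_n) r : 0 <= r ->
  (forall t, 0 <= t <= T -> forall j, {for t, continuous (fun s => Z s ord0 j)}) ->
  (forall t, 0 <= t <= T -> enorm (Z t) <= r) -> Linfty_le T Z r.
Proof.
move=> r0 cZ Zr; split=> [j|].
  apply: subspace_continuous_measurable_fun => //.
  apply: continuous_in_subspaceT => t; rewrite inE/= in_itv/= => /andP[t0 tT].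
  by apply: cZ; rewrite !ltW.
rewrite /Linfty_norm unlock /Lnorm; case: ifPn => // _.
apply/ess_supP/aeW => t /=; rewrite patchE; case: ifPn; last first.
  by rewrite normr0 lee_fin.
rewrite inE/= in_itv/= => /andP[t0 tT].
by rewrite lee_fin ger0_norm ?enorm_ge0// Zr// !ltW.
Qed.

(** Integration by parts; the test function vanishes at 0 and at [T]. *)
Let weak_deriv_classical : weak_deriv T W V.
Proof.
move=> phi j [dphi [a [b [a0 bT phi0]]]].
have d0 x : derivable phi x 1 by exact: dphi 0%N x.
have d1 x : derivable (derive1 phi) x 1 by exact: dphi 1%N x.
have cphi : continuous phi.
  by move=> x; exact/differentiable_continuous/derivable1_diffP.
have cphi' : continuous (derive1 phi).
  by move=> x; exact/differentiable_continuous/derivable1_diffP.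
have within_cont (g : R -> R) :
    (forall t, 0 <= t <= T -> {for t, continuous g}) ->
    {within `[0, T], continuous g}.
  move=> cg; apply: continuous_in_subspaceT => t; rewrite inE/= in_itv/=.
  exact: cg.
have openE (g : R -> R) :
    (forall t, 0 <= t <= T -> {for t, continuous g}) ->
    \int[mu]_(t in `]0, T[) g t = \int[mu]_(t in `[0, T]) g t.
  move=> cg; have ig : mu.-integrable `[0, T] (EFin \o g).
    apply: continuous_compact_integrable; first exact: segment_compact.
    exact: within_cont.
  rewrite Rintegral_itv_obnd_cbnd ?Rintegral_itv_bndo_bndc//.
  - by apply: integrableS ig => //; apply: subset_itvl; rewrite bnd_simp.
  - by apply: integrableS ig => //; exact: subset_itv_oo_cc.
have T_0 : 0 <= (0 : R) <= T by apply/andP; split => //; exact: ltW.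
have T_T : 0 <= T <= T by apply/andP; split => //; exact: ltW.
rewrite !openE; last 2 first.
- by move=> t tT; apply: continuousM; [exact: contV | exact: cphi].
- by move=> t tT; apply: continuousM; [exact: contW | exact: cphi'].
have p0 : phi 0 = 0 by apply: phi0; rewrite in_itv/= negb_and -!ltNge a0.
have pT : phi T = 0.
  by apply: phi0; rewrite in_itv/= negb_and -!ltNge bT orbT.
have -> := @Rintegration_by_parts R (fun s => W s ord0 j) phi
  (fun s => V s ord0 j) (derive1 phi) 0 T T0 _ _ _ _ _ _.
- by rewrite p0 pT !mulr0 subrr sub0r.
- by apply: within_cont => t tT; exact: contV.
- split=> [t||].
  + rewrite in_itv/= => /andP[t0 tT].
    by have [] := dW t _ j; rewrite ?ltW.
  + by apply: cvg_at_right_filter; exact: contW.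
  + by apply: cvg_at_left_filter; exact: contW.
- move=> t; rewrite in_itv/= => /andP[t0 tT].
  have H : is_derive t 1 (fun s => W s ord0 j) (V t ord0 j).
    by apply: dW; rewrite !ltW.
  by rewrite derive1E derive_val.
- by apply: within_cont => t tT; exact: cphi'.
- split=> [t _||].
  + exact: d0.
  + by apply: cvg_at_right_filter; exact: cphi.
  + by apply: cvg_at_left_filter; exact: cphi.
- by [].
Qed.

Lemma classical_X_space R0 R1 : 0 <= R0 -> 0 <= R1 ->
  (forall t, 0 <= t <= T -> enorm (W t) <= R0) ->
  (forall t, 0 <= t <= T -> enorm (V t) <= R1) -> X_space n T R0 R1 W.
Proof.
move=> R00 R10 WR VR; split; first exact: Linfty_le_bound.
by exists V; split=> //; exact: Linfty_le_bound.
Qed.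

End membership.

Lemma X_space_bounded_C1 T R0 R1 (Y : R -> 'rV[R]_n) :
  C1_in (time_interval T%:E) Y -> X_space n T R0 R1 Y -> bounded_C1 n T Y.
Proof.
have fin (Z : R -> 'rV[R]_n) r : Linfty_le T Z r -> Linfty_finite T Z.
  by case=> mZ Zr; split=> //; rewrite (le_lt_trans Zr)// ltry.
move=> CY [/fin HY [V [wV /fin HV]]]; split=> //; split=> //.
by exists V.
Qed.

Lemma classical_C1_in f Y0 Y1 T W V (Y : R -> 'rV[R]_n) : 
  classical f Y0 Y1 T W V -> {in time_interval T%:E, Y =1 W} ->
  C1_in (time_interval T%:E) Y.
Proof.
move=> [_ _ dW dV] YW j; exists (fun s => V s ord0 j); split.
  apply: (@is_derive_is_deriv_in R _ _ (fun s => W s ord0 j)).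
    by move=> t tT; rewrite YW.
  by move=> t [t0 tT]; apply: dW; rewrite t0 -lee_fin ltW.
apply: continuous_in_subspaceT => t; rewrite inE => -[t0 tT].
by apply: is_derive_continuous (dV t _ j); rewrite t0 -lee_fin ltW.
Qed.

End bounded_solutions.

(** * Conservation of energy *)

Section energy.
Context {R : realType} {n : nat} {p lambda : R}.
Hypotheses (p1 : 1 < p) (lambda0 : 0 <= lambda).
Implicit Types (Y : 'rV[R]_n) (W V : R -> 'rV[R]_n) (u s t T : R).

Let pB1 : 0 < p - 1. Proof. by rewrite subr_gt0. Qed.

(** Half the radial factor of the nonlinearity, as a function of [|Y|^2]; the
    potential energy is its antiderivative evaluated at [|Y|^2]. *)
Definition radial_factor u : R := lambda / 2 * Num.sqrt u `^ (p - 1).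

(** At 0, given [e], continuity of the square root is used with the tolerance
   [e^(1/(p-1))]. *)
Lemma continuous_radial_factor : continuous radial_factor.
Proof.
move=> u; apply: (@continuousM R R (cst (lambda / 2))
  (fun v => Num.sqrt v `^ (p - 1)) u); first exact: cst_continuous.
have cs := @sqrt_continuous R u; have [u0|u0] := ltP 0 u.
  apply: (@continuous_comp _ _ _ (@Num.sqrt R) (@powR R ^~ (p - 1))) => //.
  apply: is_derive_continuous; apply: is_derive1_powR.
  by rewrite sqrtr_gt0.
apply/cvgrPdist_le => /= e e0; pose d := e `^ (p - 1)^-1.
have d0 : 0 < d by rewrite powR_gt0.
rewrite (ler0_sqrtr u0) powR0 ?gt_eqF//.
move: cs => /cvgrPdist_le/(_ d d0); rewrite (ler0_sqrtr u0).
apply: filterS => v /=; rewrite !sub0r !normrN !ger0_norm ?sqrtr_ge0 ?powR_ge0//.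
move=> vd; have -> : e = d `^ (p - 1).
  by rewrite /d -powRrM mulVf ?gt_eqF// powRr1 ?ltW.
by rewrite ge0_ler_powR ?nnegrE ?sqrtr_ge0 ?(ltW d0) ?(ltW pB1).
Qed.

Definition potential_energy : R -> R := primitive radial_factor.

Let is_derive_potential u : is_derive u 1 potential_energy (radial_factor u).
Proof. exact/is_derive_primitive/continuous_radial_factor. Qed.

Lemma potential_energy_ge0 u : 0 <= u -> 0 <= potential_energy u.
Proof.
move=> u0; rewrite -[leLHS](primitive0 radial_factor).
apply: (@derivative_ge0_le R potential_energy radial_factor) => // s _.
by rewrite mulr_ge0 ?powR_ge0 ?divr_ge0.
Qed.

(** The sum of kinetic and potential energy of the motion [W] with velocity
    [V]. *)
Definition energy W V s : R :=
  (\sum_(j < n) V s ord0 j ^+ 2) / 2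
  + potential_energy (\sum_(j < n) W s ord0 j ^+ 2).

Let is_derive_sum_sqr W V s :
  (forall j, is_derive s 1 (fun r => W r ord0 j) (V s ord0 j)) ->
  is_derive s 1 (fun r => \sum_(j < n) W r ord0 j ^+ 2)
    (\sum_(j < n) 2 * W s ord0 j * V s ord0 j).
Proof.
move=> dW.
have -> : (fun r => \sum_(j < n) W r ord0 j ^+ 2) =
    \sum_(j < n) (fun r => W r ord0 j) ^+ 2.
  by rewrite fct_sumE; apply/funext => r; apply: eq_bigr => j _.
exact: is_derive_sum.
Qed.

(** The equation is conservative: where it holds the energy is stationary. *)
Lemma is_derive_energy W V s :
  (forall j, is_derive s 1 (fun r => W r ord0 j) (V s ord0 j)) ->
  (forall j, is_derive s 1 (fun r => V r ord0 j)
                           (- f_gauge lambda p (W s) ord0 j)) ->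
  is_derive s 1 (energy W V) 0.
Proof.
move=> dW dV.
pose F r : 'rV[R]_n := - f_gauge lambda p (W r).
have dV' j : is_derive s 1 (fun r => V r ord0 j) (F s ord0 j).
  by rewrite mxE; exact: dV.
have H1 := is_derive_sum_sqr V F s dV'.
have H2 := is_derive_sum_sqr W V s dW.
have H3 := is_derive1_comp (is_derive_potential _) H2.
have -> : energy W V = 2^-1 \*: (fun r => \sum_(j < n) V r ord0 j ^+ 2) +
   (potential_energy \o (fun r => \sum_(j < n) W r ord0 j ^+ 2)).
  by apply/funext => r; rewrite /energy [X in X + _ = _]mulrC.
apply: is_derive_eq; rewrite /GRing.scale/= !mulr_sumr -big_split/=.
apply: big1 => j _.
by rewrite /F mxE /f_gauge !mxE /radial_factor -/(enorm (W s)); field.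
Qed.

Let sub_itv s t r : 0 <= r <= s -> s <= t -> 0 <= r <= t.
Proof. by case/andP=> -> rs st; rewrite (le_trans rs). Qed.

(** As long as a solution of the truncated problem stays in the cube where the
    truncation is inactive, conservation of energy bounds its velocity by
    [sqrt (2 E)], hence its displacement at time [s] by [sqrt (2 E) s]. *)
Let displacement_bound Y0 Y1 r T W V t : 0 <= t -> t <= T ->
  classical (f_gauge lambda p \o truncate r) Y0 Y1 T W V ->
  (forall s, 0 <= s <= t -> cube r (W s)) ->
  forall s, 0 <= s <= t -> forall j,
    `|W s ord0 j - Y0 ord0 j| <= Num.sqrt (2 * energy W V 0) * s.
Proof.
move=> t0 tT [W0 V0 dW dV] Wr s st j; have [s0 s_le] := andP st.
rewrite -W0.
apply: (@derivative_bound_affine R (fun s => W s ord0 j) (fun s => V s ord0 j)) => //.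
  by move=> x xs; apply: dW; exact: sub_itv xs (le_trans s_le tT).
move=> x xs; have [x0 x_le] := andP xs.
have E : energy W V x = energy W V 0.
  apply: (@derivative_eq R (energy W V) (cst (energy W V 0)) (fun=> 0) x x0) => //.
  move=> y yx; have yt := sub_itv _ _ _ yx (le_trans x_le s_le).
  have yT := sub_itv _ _ _ yt tT.
  apply: is_derive_energy => i; first exact: dW.
  by have := dV y yT i; rewrite /= truncate_id//; exact: Wr.
rewrite -E -sqrtr_sqr ler_wsqrtr// /energy mulrDr mulrC divfK ?pnatr_eq0//.
apply: ler_wpDr.
  by rewrite mulr_ge0// potential_energy_ge0// sumr_ge0// => i _; rewrite sqr_ge0.
by rewrite (bigD1 j)//= lerDl sumr_ge0// => i _; rewrite sqr_ge0.
Qed.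

(** Global solvability of the defocusing equation.  The truncation radius
    exceeds by 1 what the energy bound allows up to time [T]; as the truncated
    solution is Lipschitz in time, it cannot leave the cube: the bound
    propagates by time steps of a fixed length. *)
Lemma gauge_classical_exists Y0 Y1 T : 0 <= T ->
  exists W V, classical (f_gauge lambda p) Y0 Y1 T W V.
Proof.
move=> T0.
pose E := (\sum_(j < n) Y1 ord0 j ^+ 2) / 2
  + potential_energy (\sum_(j < n) Y0 ord0 j ^+ 2).
pose kappa := Num.sqrt (2 * E); pose r := enorm Y0 + kappa * T + 1.
have kappa0 : 0 <= kappa by exact: sqrtr_ge0.
have eY0 := enorm_ge0 Y0; have eY1 := enorm_ge0 Y1.
have kT0 : 0 <= kappa * T by rewrite mulr_ge0.
have r0 : 0 <= r by rewrite !addr_ge0.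
have fL := @f_gauge_lipschitz R n p lambda p1.
have [L L0 HL] := truncate_lipschitz _ r r0 fL.
have [W [V cW]] := classical_exists _ Y0 Y1 T L T0 L0 HL.
exists W, V.
suff Wr s : 0 <= s <= T -> cube r (W s).
  by apply: classical_ext cW => t tT /=; rewrite truncate_id//; exact: Wr.
have [W0 V0 dW dV] := cW.
have EE : energy W V 0 = E by rewrite /energy W0 V0.
pose M := `|lambda| * Num.sqrt n%:R `^ p * r `^ p.
have M0 : 0 <= M by rewrite !mulr_ge0 ?powR_ge0.
pose B := enorm Y1 + M * T.
have B0 : 0 <= B by apply: addr_ge0 => //; exact: mulr_ge0.
have VB t j : 0 <= t <= T -> `|V t ord0 j| <= B.
  move=> tT; have [t0 t_le] := andP tT.
  rewrite -(subrK (Y1 ord0 j) (V t ord0 j)) (le_trans (ler_normD _ _))//.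
  rewrite addrC lerD ?coord_le_enorm//.
  apply: (@le_trans _ _ (M * t)); last by rewrite ler_wpM2l.
  rewrite -V0; apply: (@derivative_bound_affine R (fun s => V s ord0 j)) => //.
    by move=> x xt; apply: dV; exact: sub_itv xt t_le.
  move=> x _ /=; rewrite normrN.
  by apply: f_gauge_le => //; exact: truncate_cube.
pose eta := (B + 1)^-1.
have eta0 : 0 < eta by rewrite invr_gt0 ltr_wpDl.
have Beta : B * eta <= 1 by rewrite ler_pdivrMr ?ltr_wpDl// mul1r lerDl.
have improve t : 0 <= t <= T -> (forall x, 0 <= x <= t -> cube r (W x)) ->
    forall j, `|W t ord0 j| <= r - 1.
  move=> tT Wt j; have [t0 t_le] := andP tT.
  have tt : 0 <= t <= t by rewrite t0 lexx.
  have := displacement_bound _ _ _ _ _ _ _ t0 t_le cW Wt _ tt j.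
  rewrite EE -/kappa => H.
  rewrite -(subrK (Y0 ord0 j) (W t ord0 j)) (le_trans (ler_normD _ _))//.
  have := coord_le_enorm Y0 j; have : kappa * t <= kappa * T by rewrite ler_wpM2l.
  by rewrite /r; lra.
have steps k : forall x, 0 <= x <= T -> x <= k%:R * eta -> cube r (W x).
  elim: k => [|k IH] x xT.
    rewrite mul0r => x_le0; have -> : x = 0 by case/andP: xT => ? _; lra.
    move=> j; rewrite W0; have := coord_le_enorm Y0 j; rewrite /r; lra.
  have [/IH + _|kx xk j] := leP x (k%:R * eta); first exact.
  have [x0 x_le] := andP xT.
  have k0 : 0 <= k%:R * eta by rewrite mulr_ge0// ltW.
  have kT : 0 <= k%:R * eta <= T by rewrite k0 (le_trans (ltW kx)).
  have Wk := improve _ kT _ j.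
  have {}Wk : `|W (k%:R * eta) ord0 j| <= r - 1.
    apply: Wk => y /andP[y0 yk]; apply: IH => //.
    by rewrite y0 (le_trans yk)//; case/andP: kT.
  have : `|W x ord0 j - W (k%:R * eta) ord0 j| <= B * (x - k%:R * eta).
    apply: (@mean_value_bound R (fun s => W s ord0 j) (fun s => V s ord0 j)).
    - exact: ltW.
    - move=> y /andP[ky yx]; apply: dW.
      by rewrite (le_trans k0 ky) (le_trans yx).
    - move=> y /andP[ky yx]; apply: VB.
      by rewrite (le_trans k0 ky) (le_trans yx).
  have : B * (x - k%:R * eta) <= B * eta.
    rewrite ler_wpM2l//; move: xk; rewrite -natr1 mulrDl mul1r; lra.
  move=> H1 H2; rewrite -(subrK (W (k%:R * eta) ord0 j) (W x ord0 j)).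
  by rewrite (le_trans (ler_normD _ _))//; lra.
move=> sT; apply: (steps (Num.bound (T / eta))) => //.
have := archi_boundP (divr_ge0 T0 (ltW eta0)).
rewrite ltr_pdivrMr// => /ltW; apply: le_trans.
by case/andP: sT.
Qed.

End energy.

(** * Local and global well-posedness *)

Section well_posedness.
Context {R : realType} {n : nat} (p K : R) (f : 'rV[R]_n -> 'rV[R]_n)
  (rho0 rho1 : R -> R) (T1 : \bar R).
Hypotheses (n_gt0 : (1 <= n)%N) (p1 : 1 < p) (K0 : 0 <= K)
  (f_lip : locally_lipschitz f)
  (f_le : forall Y r, 0 <= r -> cube r Y -> forall j, `|f Y ord0 j| <= K * r `^ p)
  (rho0E : forall t, time_interval T1 t -> rho0 t = 1)
  (rho1E : forall t, time_interval T1 t -> rho1 t = t).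
Implicit Types (Y : 'rV[R]_n) (U W V Z : R -> 'rV[R]_n) (T r : R).

(** The constant [C] of the existence time; [2 n K C <= 1] and [C <= 1] are what
    the estimates need. *)
Definition time_constant : R := (1 + 2 * n%:R * K)^-1.

Let nK0 : 0 <= 2 * n%:R * K. Proof. by rewrite !mulr_ge0. Qed.

Lemma time_constant_gt0 : 0 < time_constant.
Proof. by rewrite invr_gt0 ltr_wpDr. Qed.

Let nKC : 2 * n%:R * K * time_constant <= 1.
Proof. by rewrite ler_pdivrMr ?ltr_wpDr// mul1r lerDr. Qed.

Let C_le1 : time_constant <= 1.
Proof. by rewrite invf_le1 ?ltr_wpDr// lerDl. Qed.

Lemma classical_solution_fin Y0 Y1 T W V : (T%:E <= T1)%E ->
  classical f Y0 Y1 T W V -> solution rho0 rho1 f Y0 Y1 T%:E W.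
Proof.
move=> TT cW; apply: (classical_solution f rho0 rho1 T1) => // t [_ tT].
exists W, V; split=> //; apply: classical_sub cW.
by rewrite -lee_fin ltW.
Qed.

Lemma admissible_time_exists R0 R1 : 0 < R0 -> 0 < R1 -> (0 < T1)%E ->
  exists T, admissible_time time_constant p R0 R1 T1 T.
Proof.
move=> R00 R10 T10; rewrite /admissible_time; set m := Num.min _ _.
have m0 : 0 < m.
  rewrite /m !lt_min !divr_gt0 ?powR_gt0 ?mulr_gt0 ?time_constant_gt0//.
case: T1 T10 => [tau||//]; last by exists m; split; rewrite ?leey.
rewrite lte_fin => tau0; exists (Num.min m tau).
split; first by rewrite lt_min m0.
  by rewrite lee_fin ge_min lexx orbT.
by rewrite ge_min lexx.
Qed.

(** On an admissible time interval the data are small relative to [R0] in the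
    sense of [small_classical], and the velocity stays in the ball of radius
    [R1]. *)
Lemma local_classical Y0 Y1 R0 R1 T : admissible_data 2 Y0 Y1 R0 R1 ->
  admissible_time time_constant p R0 R1 T1 T ->
  exists W V, [/\ classical f Y0 Y1 T W V,
    forall t, 0 <= t <= T -> enorm (W t) <= R0 &
    forall t, 0 <= t <= T -> enorm (V t) <= R1].
Proof.
move=> [R00 R10 Y0R Y1R] [T0 _]; rewrite !le_min => /and4P[_ TC TV TR].
have C0 := time_constant_gt0; have y1 := enorm_ge0 Y1.
have n1 : 1 <= n%:R :> R by rewrite ler1n.
have Y1T : 4 * T * enorm Y1 <= R0.
  apply: (@le_trans _ _ (2 * T * R1)).
    have -> : 4 * T * enorm Y1 = 2 * T * (2 * enorm Y1) by ring.
    by rewrite ler_wpM2l// mulr_ge0// ltW.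
  by move: TR; rewrite ler_pdivlMr ?mulr_gt0// mulrCA mulrA.
have small : 2 * n%:R * K * R0 `^ (p - 1) * T ^+ 2 <= 1.
  have TC' : T * R0 `^ ((p - 1) / 2) <= time_constant.
    by rewrite -ler_pdivlMr// powR_gt0.
  have -> : R0 `^ (p - 1) = (R0 `^ ((p - 1) / 2)) ^+ 2.
    by rewrite -powR_mulrn ?powR_ge0// -powRrM divfK.
  rewrite -mulrA -exprMn [_ `^ _ * T]mulrC.
  apply: le_trans nKC; rewrite ler_wpM2l//.
  apply: (@le_trans _ _ (time_constant ^+ 2)).
    by rewrite ler_sqr ?nnegrE ?mulr_ge0 ?powR_ge0 ?(ltW T0) ?(ltW C0).
  by rewrite expr2 ler_piMl ?(ltW C0).
have [W [V [cW WR VY]]] := small_classical f n_gt0 p1 K0 f_lip f_le Y0 Y1 R0 T R00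
  (ltW T0) Y0R Y1T small.
exists W, V; split=> // t tT; have [t0 t_le] := andP tT.
rewrite le_enorm ?(ltW R10)//.
pose D := K * R0 `^ p * T.
have D0 : 0 <= D by rewrite !mulr_ge0 ?powR_ge0// ltW.
have VD j : `|V t ord0 j - Y1 ord0 j| <= D.
  by rewrite (le_trans (VY t tT j))// ler_wpM2l// mulr_ge0// powR_ge0.
have DR : n%:R * D <= R1 / 2.
  have {}TV : R0 `^ p * T <= time_constant * R1.
    by rewrite mulrC -ler_pdivlMr// powR_gt0.
  apply: (@le_trans _ _ (n%:R * (K * (time_constant * R1)))).
    by rewrite /D -mulrA ler_wpM2l// ler_wpM2l.
  have -> : n%:R * (K * (time_constant * R1)) =
    R1 / 2 * (2 * n%:R * K * time_constant) by field.
  by rewrite ler_piMr// divr_ge0 ?(ltW R10).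
apply: (@le_trans _ _ (\sum_(j < n) (2 * Y1 ord0 j ^+ 2 +
    2 * (V t ord0 j - Y1 ord0 j) ^+ 2))).
  apply: ler_sum => j _.
  by have := sqr_ge0 (V t ord0 j - 2 * Y1 ord0 j); lra.
rewrite big_split/= -!mulr_sumr -sqr_enorm.
have B1 : (2 * enorm Y1) ^+ 2 <= R1 ^+ 2.
  by rewrite ler_sqr ?nnegrE ?mulr_ge0 ?(ltW R10).
have B2 : \sum_(j < n) (V t ord0 j - Y1 ord0 j) ^+ 2 <= (n%:R * D) ^+ 2.
  apply: le_trans (sum_sqr_le _ _ VD) _.
  by rewrite [leRHS]exprMn ler_wpM2r ?sqr_ge0// expr2 ler_peMl.
have B3 : (n%:R * D) ^+ 2 <= (R1 / 2) ^+ 2.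
  by rewrite ler_sqr ?nnegrE ?divr_ge0 ?(ltW R10)// mulr_ge0.
lra.
Qed.

Lemma local_unique_solution Y0 Y1 R0 R1 T :
  admissible_data 2 Y0 Y1 R0 R1 -> admissible_time time_constant p R0 R1 T1 T ->
  exists W V, classical f Y0 Y1 T W V /\
    unique_solution_in (X_space n T R0 R1) rho0 rho1 f Y0 Y1 T%:E W.
Proof.
move=> adm admT; have [R00 R10 _ _] := adm; have [T0 TT _] := admT.
have [W [V [cW WR VR]]] := local_classical _ _ _ _ _ adm admT.
have sW := classical_solution_fin _ _ _ _ _ TT cW.
exists W, V; split=> //; split=> //.
  by apply: (classical_X_space f Y0 Y1 T W V) => //; exact: ltW.
by move=> Z _; exact: (solution_unique f rho0 rho1 T1).
Qed.

Lemma is_global_solution Y0 Y1 T U Z : (T%:E <= T1)%E ->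
  solution rho0 rho1 f Y0 Y1 T%:E U -> solution rho0 rho1 f Y0 Y1 T1 Z ->
  is_global rho0 rho1 f Y0 Y1 T1 T%:E U.
Proof.
move=> TT sU sZ; exists Z; split=> //.
apply: (solution_unique f rho0 rho1 T1 _ _ _ Y0 Y1) => // t tT.
exact/sZ/(time_interval_le _ _ _ TT).
Qed.

(** On a bounded interval the radius [r] with
    [r^(p-1) = 1 / (1 + 2 n K tau^2)] admits all data of size at most
    [r / (2 + 4 tau)]. *)
Lemma small_global_solution (tau : R) : 0 < tau -> T1 = tau%:E ->
  exists delta : R, 0 < delta /\ forall Y0 Y1,
    enorm Y0 <= delta -> enorm Y1 <= delta ->
    exists Z, solution rho0 rho1 f Y0 Y1 T1 Z.
Proof.
move=> tau0 T1E; pose q := 1 + 2 * n%:R * K * tau ^+ 2.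
have q0 : 0 < q by rewrite ltr_wpDr// mulr_ge0 ?sqr_ge0.
pose r := q^-1 `^ (p - 1)^-1.
have r0 : 0 < r by rewrite powR_gt0// invr_gt0.
have rE : r `^ (p - 1) = q^-1.
  by rewrite -powRrM mulVf ?subr_eq0 ?gt_eqF// powRr1// invr_ge0 ltW.
have s0 : 0 < 2 + 4 * tau by rewrite addr_gt0// mulr_gt0.
exists (r / (2 + 4 * tau)); split=> [|Y0 Y1]; first by rewrite divr_gt0.
have y0 := enorm_ge0 Y0; have y1 := enorm_ge0 Y1.
rewrite !ler_pdivlMr// => Y0r Y1r.
have tY0 : 0 <= tau * enorm Y0 by rewrite mulr_ge0// ltW.
have tY1 : 0 <= tau * enorm Y1 by rewrite mulr_ge0// ltW.
have [||| W [V [cW _ _]]] := small_classical f n_gt0 p1 K0 f_lip f_le Y0 Y1 r tau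
  r0 (ltW tau0).
- by lra.
- by lra.
- rewrite rE mulrAC ler_pdivrMr// mul1r /q; lra.
by exists W; rewrite T1E; apply: classical_solution_fin cW; rewrite T1E.
Qed.

(** Classical solutions on every bounded interval agree with each other, and
    glue to a solution on the whole of [0, T1). *)
Lemma glued_solution Y0 Y1 :
  (forall T, 0 <= T -> exists W V, classical f Y0 Y1 T W V) ->
  exists Z, solution rho0 rho1 f Y0 Y1 T1 Z.
Proof.
move=> ex; have /choice[w Hw] (T : R) : exists W : R -> 'rV[R]_n,
    0 <= T -> exists V, classical f Y0 Y1 T W V.
  have [T0|T0] := leP 0 T; first by have [W HW] := ex T T0; exists W.
  by exists (fun=> 0).
exists (fun t => w t t).
apply: (classical_solution f rho0 rho1 T1) => // t [t0 _].
have [V cW] := Hw t t0; exists (w t), V; split=> // s /andP[s0 st].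
have [V' cW'] := Hw s s0.
apply: (classical_unique _ _ _ _ _ _ _ _ f_lip (classical_sub _ _ _ _ _ _ _ st cW) cW').
by rewrite s0 lexx.
Qed.

End well_posedness.

Theorem theorem2 (R : realType) (n : nat) (a0 a1 sigma lambda p : R)
    (f : 'rV[R]_n -> 'rV[R]_n) (rho0 rho1 : R -> R)
    (hn : (1 <= n)%N) (ha0 : 0 < a0)
    (hcase : a1 = 0 \/ (a1 <> 0 /\ sigma = -1 + 2 / n%:R))
    (hp : 1 < p)
    (hf : f = f_gauge lambda p \/ f = f_power lambda p)
    (hrho0 : linear_ivp (time_interval (T_1 n a0 a1 sigma))
               (potential n a0 a1 sigma) 1 0 rho0)
    (hrho1 : linear_ivp (time_interval (T_1 n a0 a1 sigma))
               (potential n a0 a1 sigma) 0 1 rho1) :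
  let T1 := T_1 n a0 a1 sigma in
  exists C0 C : R, [/\ 0 < C0, 0 < C,
    (* (1) *)
    (forall (Y0 Y1 : 'rV[R]_n) (R0 R1 : R), admissible_data C0 Y0 Y1 R0 R1 ->
       (exists T : R, admissible_time C p R0 R1 T1 T) /\
       (forall T : R, admissible_time C p R0 R1 T1 T ->
          exists Y : R -> 'rV[R]_n,
            unique_solution_in (X_space n T R0 R1) rho0 rho1 f Y0 Y1 T%:E Y)),
    (* (2) *)
    (sigma = -1 + 2 / n%:R -> a1 < 0 ->
       exists delta : R, 0 < delta /\
         forall (Y0 Y1 : 'rV[R]_n) (R0 R1 T : R) (Y : R -> 'rV[R]_n),
           enorm Y0 <= delta -> enorm Y1 <= delta ->
           admissible_data C0 Y0 Y1 R0 R1 -> admissible_time C p R0 R1 T1 T ->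
           unique_solution_in (X_space n T R0 R1) rho0 rho1 f Y0 Y1 T%:E Y ->
           is_global rho0 rho1 f Y0 Y1 T1 T%:E Y) &
    (* (a), (b), (c) *)
    (forall (Y0 Y1 : 'rV[R]_n) (R0 R1 T : R) (Y : R -> 'rV[R]_n),
       admissible_data C0 Y0 Y1 R0 R1 -> admissible_time C p R0 R1 T1 T ->
       unique_solution_in (X_space n T R0 R1) rho0 rho1 f Y0 Y1 T%:E Y ->
       [/\ C1_in (time_interval T%:E) Y,
           unique_solution_in (bounded_C1 n T) rho0 rho1 f Y0 Y1 T%:E Y &
           (0 <= lambda -> f = f_gauge lambda p ->
              is_global rho0 rho1 f Y0 Y1 T1 T%:E Y)])].
Proof.
move=> T1.
have rho0E t : time_interval T1 t -> rho0 t = 1.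
  by move=> tT; rewrite (linear_ivp_affine hn ha0 hcase _ _ _ hrho0)// mul0r addr0.
have rho1E t : time_interval T1 t -> rho1 t = t.
  by move=> tT; rewrite (linear_ivp_affine hn ha0 hcase _ _ _ hrho1)// mul1r add0r.
have HT := @T_1_cases R n a0 a1 sigma hn hcase.
have T10 : (0 < T1)%E.
  case: HT => -[a10]; rewrite -/T1 => ->; last exact: ltry.
  by rewrite lte_fin oppr_gt0 pmulr_rlt0// invr_lt0.
pose K := `|lambda| * Num.sqrt n%:R `^ p.
have K0 : 0 <= K by rewrite mulr_ge0 ?powR_ge0.
have f_lip : locally_lipschitz f.
  by case: hf => ->; [exact: f_gauge_lipschitz | exact: f_power_lipschitz].
have f_le Y r : 0 <= r -> cube r Y -> forall j, `|f Y ord0 j| <= K * r `^ p.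
  by case: hf => ->; [exact: f_gauge_le | exact: f_power_le].
exists 2, (time_constant (n := n) K); split => //.
- exact: time_constant_gt0.
- move=> Y0 Y1 R0 R1 adm; have [R00 R10 _ _] := adm.
  split; first exact: admissible_time_exists.
  move=> T admT.
  have [W [_ [_ uW]]] := local_unique_solution p K f rho0 rho1 T1 hn hp K0 f_lip
    f_le rho0E rho1E _ _ _ _ _ adm admT.
  by exists W.
- move=> _ a1lt0.
  have [tau tau0 T1E] : exists2 tau : R, 0 < tau & T1 = tau%:E.
    case: HT => -[a10 T1E]; last by move: a1lt0; rewrite ltNge a10.
    exists (- (a0 / a1)) => //.
    by rewrite oppr_gt0 pmulr_rlt0// invr_lt0.
  have [delta [delta0 Hdelta]] := small_global_solution p K f rho0 rho1 T1 hn hp K0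
    f_lip f_le rho0E rho1E tau tau0 T1E.
  exists delta; split=> // Y0 Y1 R0 R1 T Y Y0d Y1d _ [_ TT _] [_ sY _].
  have [Z sZ] := Hdelta Y0 Y1 Y0d Y1d.
  exact: is_global_solution sY sZ.
- move=> Y0 Y1 R0 R1 T Y adm admT [XY sY uY]; have [_ TT _] := admT.
  have [W [V [cW [XW sW _]]]] := local_unique_solution p K f rho0 rho1 T1 hn hp K0
    f_lip f_le rho0E rho1E _ _ _ _ _ adm admT.
  have CY : C1_in (time_interval T%:E) Y.
    by apply: classical_C1_in cW _ => t tT; rewrite (uY W).
  split=> //.
    split=> //; first exact: X_space_bounded_C1 XY.
    by move=> Z _; exact: (solution_unique f rho0 rho1 T1).
  move=> lambda0 fE.
  have [Z sZ] : exists Z, solution rho0 rho1 f Y0 Y1 T1 Z.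
    apply: glued_solution => // T' T'0; rewrite fE.
    exact: gauge_classical_exists.
  exact: is_global_solution sY sZ.
Qed.
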